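(* Let $n\in\mathbb N$, $q>1$ and $p\in(\tfrac23 q+1,\,q+\tfrac23)$. (i) If $(\gamma_k)_{k\in\mathbb N}$ is a sequence of embedded curves in $W^{(3p-2)/q-1,q}(\mathbb R/\mathbb Z,\mathbb R^n)$ uniformly converging to a non-injective curve $\gamma_\infty\in C^{0,1}(\mathbb R/\mathbb Z,\mathbb R^n)$ parametrized by arc-length, then $\mathrm{intM}^{(p,q)}(\gamma_k)\to\infty$ as $k\to\infty$. (ii) For given $E,L>0$ there are only finitely many knot types having a representative $\gamma$ (an injective regular $C^1$ curve) with $\mathrm{intM}^{(p,q)}(\gamma)<E$ and length equal to $L$.
   Context: For $a,b\in\mathbb R^n$ put $|a\wedge b|=\sqrt{|a|^2|b|^2-\langle a,b\rangle^2}$. For an absolutely continuous curve $\gamma:\mathbb R/\mathbb Z\to\mathbb R^n$ the generalized integral Menger curvature is $$\mathrm{intM}^{(p,q)}(\gamma)=\iiint_{(\mathbb R/\mathbb Z)^3}\frac{|(y-x)\wedge(z-x)|^q}{(|y-z||y-x||z-x|)^p}\,|\gamma'(u_1)||\gamma'(u_2)||\gamma'(u_3)|\,du_1\,du_2\,du_3,$$ with $x=\gamma(u_1)$, $y=\gamma(u_2)$, $z=\gamma(u_3)$. Embedded means injective; arc-length parametrized means $|\gamma'|=1$ a.e.; regular means $|\gamma'|\ge c$ a.e. for some $c>0$. A knot type is an ambient isotopy class of embedded closed curves in $\mathbb R^n$. Sobolev–Slobodeckij spaces: for $s\in(0,1)$, $\rho\in[1,\infty)$, $W^{1+s,\rho}(\mathbb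 R/\mathbb Z,\mathbb R^n)$ is the set of $f\in W^{1,\rho}$ with $\int_{\mathbb R/\mathbb Z}\int_{-1/2}^{1/2}\frac{|f'(u+w)-f'(u)|^\rho}{|w|^{1+\rho s}}\,dw\,du<\infty$; for the given $p,q$ one has $(3p-2)/q-1\in(1+\tfrac1q,2)$. *)

(* Defs.v *)
From HB Require Import structures.
From mathcomp Require Import all_boot all_order all_algebra.
From mathcomp Require Import all_classical all_reals all_analysis.

Set Implicit Arguments.
Unset Strict Implicit.
Unset Printing Implicit Defensive.

Import Order.TTheory GRing.Theory Num.Theory.
Import numFieldNormedType.Exports.

Local Open Scope classical_set_scope.
Local Open Scope ring_scope.

(* Maps on R/Z are represented by 1-periodic maps on R, and integrals over R/Z
   by integrals over [0, 1].  The topology of 'rV[R]_n is the library's, but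
   the library norm is the maximum norm, so the Euclidean one is defined
   here. *)

Section Euclidean.
Context {R : realType} {n : nat}.
Implicit Types a b : 'rV[R]_n.

Definition dotp a b : R := \sum_(i < n) a ord0 i * b ord0 i.

Definition enorm a : R := Num.sqrt (dotp a a).

Definition wedge_norm a b : R :=
  Num.sqrt (enorm a ^+ 2 * enorm b ^+ 2 - dotp a b ^+ 2).

End Euclidean.

Definition periodic1 {R : realType} {T : Type} (f : R -> T) : Prop :=
  forall t, f (t + 1) = f t.

Section Curves.
Context {R : realType} {n : nat}.
Implicit Types g : R -> 'rV[R]_n.

Let mu := @lebesgue_measure R.

Definition injective_curve g : Prop := {in `[0, 1[ &, injective g}.

Definition embedded g : Prop :=
  [/\ continuous g, periodic1 g & injective_curve g].

(* [derive1 g] is the pointwise derivative; for an absolutely continuous curve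
   it exists almost everywhere, and at the remaining points the [lim] of the
   divergent difference quotients is a default value. *)
Definition arc_length_parametrized g : Prop :=
  {ae mu, forall t, enorm (derive1 g t) = 1}.

Definition regular_curve g : Prop :=
  exists2 c : R, 0 < c & {ae mu, forall t, c <= enorm (derive1 g t)}.

Definition C1_curve g : Prop :=
  (forall t, derivable g t 1) /\ continuous (derive1 g).

Definition C01_curve g : Prop :=
  exists K : R, forall s t, enorm (g s - g t) <= K * `|s - t|.

Definition curve_length g : \bar R :=
  (\int[mu]_(t in `[0%R, 1%R]) (enorm (derive1 g t))%:E)%E.

(* Where two of the three points coincide the quotient is 0 (as x / 0 = 0);
   for an embedded curve this is a null set of parameters. *)
Definition menger_integrand (p q : R) (x y z : 'rV[R]_n) : R :=
  wedge_norm (y - x) (z - x) `^ q /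
  (enorm (y - z) * enorm (y - x) * enorm (z - x)) `^ p.

Definition intM (p q : R) g : \bar R :=
  (\int[mu]_(u1 in `[0%R, 1%R]) \int[mu]_(u2 in `[0%R, 1%R])
   \int[mu]_(u3 in `[0%R, 1%R])
     (menger_integrand p q (g u1) (g u2) (g u3) *
      enorm (derive1 g u1) * enorm (derive1 g u2) * enorm (derive1 g u3))%:E)%E.

End Curves.

Section Sobolev.
Context {R : realType} {n : nat}.
Implicit Types f h : R -> 'rV[R]_n.

Let mu := @lebesgue_measure R.

Definition Lrho (rho : R) f : Prop :=
  [/\ periodic1 f,
      forall i, measurable_fun setT (fun t => f t ord0 i) &
      (\int[mu]_(t in `[0%R, 1%R]) (enorm (f t) `^ rho)%:E < +oo)%E].

Definition test_function (phi : R -> R) : Prop :=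
  periodic1 phi /\ forall k t, derivable (derive1n k phi) t 1.

Definition weak_derivative f h : Prop :=
  forall (i : 'I_n) (phi : R -> R), test_function phi ->
    \int[mu]_(t in `[0, 1]) (f t ord0 i * derive1 phi t) =
    - \int[mu]_(t in `[0, 1]) (h t ord0 i * phi t).

Definition slobodeckij_integral (s rho : R) h : \bar R :=
  (\int[mu]_(u in `[0%R, 1%R]) \int[mu]_(w in `[(- 2^-1)%R, (2^-1)%R])
     (enorm (h (u + w) - h u)%R `^ rho / `|w| `^ (1 + rho * s))%:E)%E.

(* [W^{sigma, rho}(R/Z, R^n)] for [1 < sigma < 2], that is [W^{1 + s, rho}]
   with [s = sigma - 1]. *)
Definition sobolev_slobodeckij (sigma rho : R) f : Prop :=
  Lrho rho f /\
  exists h, [/\ Lrho rho h, weak_derivative f h &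
    (slobodeckij_integral (sigma - 1) rho h < +oo)%E].

End Sobolev.

Section Knots.
Context {R : realType} {n : nat}.

Definition homeomorphism (T U : topologicalType) (f : T -> U) : Prop :=
  exists f' : U -> T,
    [/\ cancel f f', cancel f' f, continuous f & continuous f'].

Definition ambient_isotopic (A B : set 'rV[R]_n) : Prop :=
  exists H : R * 'rV[R]_n -> 'rV[R]_n,
    [/\ {within `[0, 1] `*` [set: 'rV[R]_n], continuous H},
        forall x, H (0, x) = x,
        forall t, t \in `[0, 1] -> homeomorphism (fun x => H (t, x)) &
        [set H (1, x) | x in A] = B].

(* Knots are unoriented: curves are compared through their images. *)
Definition is_knot_type (K : set (R -> 'rV[R]_n)) : Prop :=
  exists2 g0, embedded g0 &
    K = [set g | embedded g /\ ambient_isotopic (range g0) (range g)].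

End Knots.

(* Main.v *)
(* If three points of a curve span a triangle of large area compared with its
   sides, so do all points of three arcs around them, and these arcs alone
   contribute a power of the scale to the energy.  Since 3 p - 3 - 2 q > 0, an
   energy bound forces the curve to be flat: in a ball of radius d the directions
   of the secants from a point turn by O(d^k) between the scales d and 2 d.  As
   the sum over dyadic scales converges, all secants in a small ball are nearly
   parallel, uniformly over the curves of bounded energy; an embedded curve is
   therefore projected injectively to a line there, and two points that are
   close in space are joined by a short arc.

   (i) This survives uniform limits, so that a limit of curves of bounded energy
   is injective unless it is constant on an arc, which arc-length parametrization
   excludes.  The energy estimate only needs a lower bound for the speed along
   the curve; for a Sobolev curve it is obtained by testing the weak derivative
   against primitives of the kernels ((1 + cos (2 pi t)) / 2)^k.

   (ii) A unit-speed parametrization of a curve of bounded energy and length L is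
   nearly straight on arcs of a fixed length and keeps points at a larger arc
   distance a fixed distance apart.  Two such parametrizations that are close on
   a fixed finite grid differ by a Lipschitz function of the point of the first
   curve, with a constant < 1.  A McShane extension Phi of this function gives
   the ambient isotopy x + t Phi(x), and finitely many roundings of the values
   on the grid exist. *)

Require Import Defs.
From HB Require Import structures.
From mathcomp Require Import all_boot all_order all_algebra.
From mathcomp Require Import all_classical all_reals all_analysis.
From mathcomp Require Import measurable_realfun ring lra.

Set Implicit Arguments.
Unset Strict Implicit.
Unset Printing Implicit Defensive.

Import Order.TTheory GRing.Theory Num.Theory.
Import numFieldNormedType.Exports.

Local Open Scope classical_set_scope.
Local Open Scope ring_scope.

(** The exponent k is forced by scaling. If three points in a ball of radius r span a parallelogram
    of area W, moving each by a small fixed multiple of W / r keeps the area above W / 2, so arcs of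
    that size give energy at least c (W / r)^3 W^q / r^(3 p). Hence W <= C r^(2 + k) with k = (3 p -
    3 - 2 q) / (q + 3), positive by the lower bound on p. The constants depend on p, q, n and the
    energy bound, never on the curve; so no subsequence is extracted: in (i) the radius is fixed
    before the index, in (ii) the grid before the curve. Flatness concerns points in space,
    embeddedness concerns parameters; the two are linked by intermediate values of distances and of
    projections. Curves are compared in the maximum norm, in which an extension made coordinate by
    coordinate keeps its Lipschitz constant. The price is factors n + 1, taken instead of n so that
    n = 0 needs no separate case. *)

(** * Semi-inner products *)

Section SemiInnerProduct.
Context {R : realType} {V : lmodType R} (B : V -> V -> R).
Hypothesis BDl : forall x y z, B (x + y) z = B x z + B y z.
Hypothesis BZl : forall c x z, B (c *: x) z = c * B x z.
Hypothesis BC : forall x y, B x y = B y x.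
Hypothesis B_ge0 : forall x, 0 <= B x x.

Let BDr x y z : B x (y + z) = B x y + B x z.
Proof. by rewrite BC BDl !(BC x). Qed.

Let BZr c x y : B x (c *: y) = c * B x y.
Proof. by rewrite BC BZl BC. Qed.

Lemma semi_cauchy_schwarz x y : B x y ^+ 2 <= B x x * B y y.
Proof.
have expand t : B (x + t *: y) (x + t *: y) =
    B x x + 2 * t * B x y + t ^+ 2 * B y y.
  by rewrite BDl !BDr !(BZl, BZr) (BC y x); ring.
(* The form may be degenerate: if [B y y = 0], the expansion is affine in [t], and a nonzero slope
   would make it -1 somewhere. *)
have [y0|y_neq0] := eqVneq (B y y) 0.
  have [->|b0] := eqVneq (B x y) 0; first by rewrite expr0n/= y0 mulr0.
  have := B_ge0 (x + (- (1 + B x x) / (2 * B x y)) *: y).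
  rewrite expand y0 mulr0 addr0.
  have -> : 2 * (- (1 + B x x) / (2 * B x y)) * B x y = - (1 + B x x) by field.
  by rewrite opprD addrCA subrr addr0 oppr_ge0 ler10.
have y_gt0 : 0 < B y y by rewrite lt_neqAle eq_sym y_neq0 B_ge0.
have := B_ge0 (x + (- B x y / B y y) *: y).
have -> : B (x + (- B x y / B y y) *: y) (x + (- B x y / B y y) *: y) =
    (B x x * B y y - B x y ^+ 2) / B y y by rewrite expand; field.
by rewrite pmulr_lge0 ?invr_gt0// subr_ge0.
Qed.

Lemma semi_norm_triangle x y :
  Num.sqrt (B (x + y) (x + y)) <= Num.sqrt (B x x) + Num.sqrt (B y y).
Proof.
rewrite -[leRHS]ger0_norm ?addr_ge0 ?sqrtr_ge0// -sqrtr_sqr.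
apply: ler_wsqrtr; rewrite sqrrD !sqr_sqrtr// -sqrtrM//.
have -> : B (x + y) (x + y) = B x x + B x y *+ 2 + B y y.
  by rewrite BDl !BDr (BC y x); ring.
rewrite lerD2r lerD2l lerMn2r/= (le_trans (ler_norm _))// -sqrtr_sqr.
by apply: ler_wsqrtr; exact: semi_cauchy_schwarz.
Qed.

End SemiInnerProduct.

(** * Angles between lines in Euclidean space *)

Section EuclideanGeometry.
Context {R : realType} {n : nat}.
Implicit Types a b c u v w x y z : 'rV[R]_n.

Lemma dotpC a b : dotp a b = dotp b a.
Proof. by apply: eq_bigr => i _; rewrite mulrC. Qed.

Lemma dotpDl a b c : dotp (a + b) c = dotp a c + dotp b c.
Proof. by rewrite -big_split; apply: eq_bigr => i _; rewrite mxE mulrDl. Qed.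

Lemma dotpZl (k : R) a b : dotp (k *: a) b = k * dotp a b.
Proof. by rewrite mulr_sumr; apply: eq_bigr => i _; rewrite mxE mulrA. Qed.

Lemma dotpDr a b c : dotp a (b + c) = dotp a b + dotp a c.
Proof. by rewrite dotpC dotpDl !(dotpC a). Qed.

Lemma dotpZr (k : R) a b : dotp a (k *: b) = k * dotp a b.
Proof. by rewrite dotpC dotpZl dotpC. Qed.

Lemma dotpNl a b : dotp (- a) b = - dotp a b.
Proof. by rewrite -scaleN1r dotpZl mulN1r. Qed.

Lemma dotpNr a b : dotp a (- b) = - dotp a b.
Proof. by rewrite dotpC dotpNl dotpC. Qed.

Lemma dotpBl a b c : dotp (a - b) c = dotp a c - dotp b c.
Proof. by rewrite dotpDl dotpNl. Qed.

Lemma dotpp_ge0 a : 0 <= dotp a a.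
Proof. by apply: sumr_ge0 => i _; rewrite -expr2 sqr_ge0. Qed.

Lemma enorm_ge0 a : 0 <= enorm a. Proof. exact: sqrtr_ge0. Qed.

Lemma sqr_enorm a : enorm a ^+ 2 = dotp a a.
Proof. by rewrite sqr_sqrtr// dotpp_ge0. Qed.

Lemma enorm0 : enorm (0 : 'rV[R]_n) = 0.
Proof. by rewrite /enorm -(scale0r 0) dotpZl mul0r sqrtr0. Qed.

Lemma enormN a : enorm (- a) = enorm a.
Proof. by rewrite /enorm dotpNl dotpNr opprK. Qed.

Lemma enorm_distC a b : enorm (a - b) = enorm (b - a).
Proof. by rewrite -opprB enormN. Qed.

Lemma enormZ (k : R) a : enorm (k *: a) = `|k| * enorm a.
Proof.
by rewrite /enorm dotpZl dotpZr mulrA -expr2 sqrtrM ?sqr_ge0// sqrtr_sqr.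
Qed.

Lemma enormD a b : enorm (a + b) <= enorm a + enorm b.
Proof.
apply: (semi_norm_triangle (B := @dotp R n)).
- exact: dotpDl.
- exact: dotpZl.
- exact: dotpC.
- exact: dotpp_ge0.
Qed.

Lemma enorm_distD b a c : enorm (a - c) <= enorm (a - b) + enorm (b - c).
Proof. by rewrite -(subrKA b) enormD. Qed.

Lemma dotp_le_enorm a b : `|dotp a b| <= enorm a * enorm b.
Proof.
rewrite -sqrtr_sqr -sqrtrM ?dotpp_ge0//; apply: ler_wsqrtr.
apply: semi_cauchy_schwarz.
- exact: dotpDl.
- exact: dotpZl.
- exact: dotpC.
- exact: dotpp_ge0.
Qed.

Lemma coord_le_enorm a i : `|a ord0 i| <= enorm a.
Proof.
rewrite -sqrtr_sqr; apply: ler_wsqrtr.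
rewrite /dotp (bigD1 i)//= -expr2 lerDl.
by apply: sumr_ge0 => j _; rewrite -expr2 sqr_ge0.
Qed.

Lemma enorm_le_sum a : enorm a <= \sum_(i < n) `|a ord0 i|.
Proof.
rewrite -[leRHS]ger0_norm ?sumr_ge0// -sqrtr_sqr; apply: ler_wsqrtr.
rewrite expr2 mulr_suml; apply: ler_sum => i _.
rewrite (le_trans (ler_norm _))// normrM ler_wpM2l//.
by rewrite (bigD1 i)//= lerDl sumr_ge0.
Qed.

Lemma enorm_le_coord a (M : R) :
  (forall i, `|a ord0 i| <= M) -> enorm a <= n%:R * M.
Proof.
move=> aM; rewrite (le_trans (enorm_le_sum a))//.
rewrite (le_trans (ler_sum _ (fun i _ => aM i)))//.
by rewrite sumr_const card_ord mulr_natl.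
Qed.

Lemma norm_le_coord a (M : R) : 0 <= M ->
  (forall i, `|a ord0 i| <= M) -> `|a| <= M.
Proof.
move=> M0 aM; rewrite [leLHS]/Num.Def.normr/= mx_normrE.
by apply: bigmax_le => // -[i j] _ /=; rewrite ord1.
Qed.

Lemma coord_le_norm a i : `|a ord0 i| <= `|a|.
Proof.
rewrite [leRHS]/Num.Def.normr/= mx_normrE.
exact: (le_bigmax _ (fun ij : 'I_1 * 'I_n => `|a ij.1 ij.2|) (ord0, i)).
Qed.

Lemma norm_le_enorm a : `|a| <= enorm a.
Proof. by apply: norm_le_coord => [|i]; [exact: enorm_ge0|exact: coord_le_enorm]. Qed.

Lemma enorm_le_norm a : enorm a <= n%:R * `|a|.
Proof. by apply: enorm_le_coord => i; exact: coord_le_norm. Qed.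

Lemma enorm_eq0 a : (enorm a == 0) = (a == 0).
Proof.
apply/eqP/eqP => [a0|->]; last exact: enorm0.
by apply/eqP; rewrite -normr_le0 -a0 norm_le_enorm.
Qed.

Lemma enorm_gt0 a : (0 < enorm a) = (a != 0).
Proof. by rewrite lt_neqAle eq_sym enorm_eq0 enorm_ge0 andbT. Qed.

Lemma enorm_scale_inv a : a != 0 -> enorm ((enorm a)^-1 *: a) = 1.
Proof.
move=> a0; rewrite enormZ ger0_norm ?invr_ge0 ?enorm_ge0//.
by rewrite mulVf// enorm_eq0.
Qed.

Lemma sqr_wedge_norm a b :
  wedge_norm a b ^+ 2 = enorm a ^+ 2 * enorm b ^+ 2 - dotp a b ^+ 2.
Proof.
rewrite sqr_sqrtr// subr_ge0 -exprMn -real_normK ?num_real//.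
by rewrite ler_pXn2r ?nnegrE// ?mulr_ge0 ?enorm_ge0// dotp_le_enorm.
Qed.

Lemma wedge_ge0 a b : 0 <= wedge_norm a b. Proof. exact: sqrtr_ge0. Qed.

Lemma wedgeC a b : wedge_norm a b = wedge_norm b a.
Proof. by rewrite /wedge_norm mulrC dotpC. Qed.

Lemma wedgeZl (k : R) a b : wedge_norm (k *: a) b = `|k| * wedge_norm a b.
Proof.
rewrite /wedge_norm enormZ dotpZl !exprMn -mulrA -normrX.
rewrite (ger0_norm (sqr_ge0 k)) -mulrBr sqrtrM ?sqr_ge0//.
by rewrite sqrtr_sqr.
Qed.

Lemma wedgeZr (k : R) a b : wedge_norm a (k *: b) = `|k| * wedge_norm a b.
Proof. by rewrite wedgeC wedgeZl wedgeC. Qed.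

Lemma wedgeNl a b : wedge_norm (- a) b = wedge_norm a b.
Proof. by rewrite -scaleN1r wedgeZl normrN1 mul1r. Qed.

Lemma wedgeNr a b : wedge_norm a (- b) = wedge_norm a b.
Proof. by rewrite wedgeC wedgeNl wedgeC. Qed.

Lemma wedge0l a : wedge_norm 0 a = 0.
Proof. by rewrite -(scale0r 0) wedgeZl normr0 mul0r. Qed.

Lemma wedge0r a : wedge_norm a 0 = 0.
Proof. by rewrite wedgeC wedge0l. Qed.

Lemma wedgexx a : wedge_norm a a = 0.
Proof. by rewrite /wedge_norm -sqr_enorm expr2 subrr sqrtr0. Qed.

Lemma wedgeBl a b c : wedge_norm (a - b) c = wedge_norm (b - a) c.
Proof. by rewrite -opprB wedgeNl. Qed.

Lemma wedgeBr a b c : wedge_norm a (b - c) = wedge_norm a (c - b).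
Proof. by rewrite -opprB wedgeNr. Qed.

Lemma wedge_le a b : wedge_norm a b <= enorm a * enorm b.
Proof.
rewrite -[leRHS]ger0_norm ?mulr_ge0 ?enorm_ge0// -sqrtr_sqr.
by apply: ler_wsqrtr; rewrite exprMn gerBl sqr_ge0.
Qed.

(* [b |-> wedge_norm a b] is the seminorm of a semi-inner product, positive by
   Cauchy-Schwarz. *)
Lemma wedgeDr a b c :
  wedge_norm a (b + c) <= wedge_norm a b + wedge_norm a c.
Proof.
pose B b c := dotp a a * dotp b c - dotp a b * dotp a c.
have wE x : wedge_norm a x = Num.sqrt (B x x).
  by rewrite /wedge_norm !sqr_enorm expr2.
rewrite !wE; apply: semi_norm_triangle => [x y z|k x y|x y|x]; rewrite /B.
- by rewrite dotpDl dotpDr; ring.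
- by rewrite dotpZl dotpZr; ring.
- by rewrite dotpC; ring.
- by have := sqr_ge0 (wedge_norm a x); rewrite sqr_wedge_norm !sqr_enorm expr2.
Qed.

Lemma wedgeDl a b c :
  wedge_norm (a + b) c <= wedge_norm a c + wedge_norm b c.
Proof. by rewrite !(wedgeC _ c) wedgeDr. Qed.

(** Divided by the three norms, this is subadditivity of the sine of the angle between lines. The
    part of [u] along [w] contributes [wedge_norm w v]; the orthogonal part, scaled to [p] to avoid
    a division, has norm [enorm w * wedge_norm u w]. *)
Lemma wedge_trans u v w : wedge_norm u v * enorm w <=
  wedge_norm u w * enorm v + wedge_norm w v * enorm u.
Proof.
have [->|w0] := eqVneq w 0.
  by rewrite enorm0 mulr0 addr_ge0// mulr_ge0 ?wedge_ge0 ?enorm_ge0.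
have wp : 0 < enorm w by rewrite enorm_gt0.
pose p := enorm w ^+ 2 *: u - dotp u w *: w.
have np : enorm p = enorm w * wedge_norm u w.
  rewrite -[RHS]ger0_norm ?mulr_ge0 ?enorm_ge0 ?wedge_ge0// -sqrtr_sqr.
  congr Num.sqrt; rewrite exprMn sqr_wedge_norm /p !sqr_enorm.
  rewrite -scaleNr dotpDl !dotpDr !(dotpZl, dotpZr) (dotpC w u).
  by ring.
have dec : enorm w ^+ 2 *: u = dotp u w *: w + p by rewrite /p addrC subrK.
rewrite -(ler_pM2l wp).
have -> : enorm w * (wedge_norm u v * enorm w) = wedge_norm (enorm w ^+ 2 *: u) v.
  by rewrite wedgeZl ger0_norm ?sqr_ge0//; ring.
rewrite dec (le_trans (wedgeDl _ _ _))// wedgeZl mulrDr addrC.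
apply: lerD.
  by rewrite (le_trans (wedge_le _ _))// np mulrA.
rewrite mulrCA mulrC (mulrC (enorm w)) ler_wpM2l ?wedge_ge0//.
exact: dotp_le_enorm.
Qed.

Lemma parallel_trans w u v (d d' : R) : w != 0 ->
  wedge_norm u w <= d * (enorm u * enorm w) ->
  wedge_norm w v <= d' * (enorm w * enorm v) ->
  wedge_norm u v <= (d + d') * (enorm u * enorm v).
Proof.
rewrite -enorm_gt0 => w0 uw wv; rewrite -(ler_pM2r w0).
rewrite (le_trans (wedge_trans u v w))//.
have := ler_wpM2r (enorm_ge0 v) uw; have := ler_wpM2r (enorm_ge0 u) wv.
lra.
Qed.

(** If the sine is at most [d], the squared cosine is at least 1 - d^2, which is at least (1 - d)^2
    on [0, 1]. *)
Lemma dotp_parallel_ge u v (d : R) : 0 <= d <= 1 ->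
  wedge_norm u v <= d * (enorm u * enorm v) ->
  (1 - d) * (enorm u * enorm v) <= `|dotp u v|.
Proof.
move=> /andP[d0 d1] uv.
have uv0 : 0 <= enorm u * enorm v by rewrite mulr_ge0 ?enorm_ge0.
rewrite -(@ler_pXn2r _ 2)// ?nnegrE// ?mulr_ge0 ?subr_ge0 ?enorm_ge0//.
rewrite real_normK ?num_real//.
have -> : dotp u v ^+ 2 = (enorm u * enorm v) ^+ 2 - wedge_norm u v ^+ 2.
  by rewrite sqr_wedge_norm; ring.
have : wedge_norm u v ^+ 2 <= (d * (enorm u * enorm v)) ^+ 2.
  by rewrite ler_pXn2r ?nnegrE ?wedge_ge0// mulr_ge0.
move: uv0; set t := enorm u * enorm v => uv0 h; clearbody t.
rewrite exprMn in h; rewrite exprMn.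
apply: (@le_trans _ _ (t ^+ 2 - d ^+ 2 * t ^+ 2)); last by rewrite lerD2l lerN2.
rewrite -subr_ge0.
have -> : t ^+ 2 - d ^+ 2 * t ^+ 2 - (1 - d) ^+ 2 * t ^+ 2 =
  (2 * d * (1 - d)) * t ^+ 2 by ring.
by rewrite !mulr_ge0// ?subr_ge0// sqr_ge0.
Qed.

(** The left side squared is 2 |u|^2 (1 - cos), and 1 - cos <= 1 - cos^2 as the cosine is in [0, 1].
    The sign of [dotp u v] turns a bound on lines into one on oriented directions. *)
Lemma near_direction u v (d : R) : 0 <= d -> enorm v = 1 -> 0 <= dotp u v ->
  wedge_norm u v <= d * (enorm u * enorm v) ->
  enorm (u - enorm u *: v) <= 2 * d * enorm u.
Proof.
move=> d0 v1 uv0; rewrite v1 mulr1 => uv.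
have := dotp_le_enorm u v; rewrite v1 mulr1 ger0_norm// => uvle.
have u0 := enorm_ge0 u.
rewrite -(@ler_pXn2r _ 2)// ?nnegrE ?enorm_ge0// ?mulr_ge0//.
rewrite sqr_enorm -scaleNr dotpDl !dotpDr !(dotpZl, dotpZr) (dotpC v u).
rewrite -!sqr_enorm v1.
have : wedge_norm u v ^+ 2 <= (d * enorm u) ^+ 2.
  by rewrite ler_pXn2r ?nnegrE ?wedge_ge0// mulr_ge0.
rewrite sqr_wedge_norm v1 expr1n mulr1 !exprMn => h.
nra.
Qed.

End EuclideanGeometry.

(** * Ambient isotopy is an equivalence *)

Lemma continuous_within_comp {S T U : topologicalType} (A : set S) (B : set T)
    (f : S -> T) (h : T -> U) :
  {within A, continuous f} -> (forall x, A x -> B (f x)) ->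
  {within B, continuous h} -> {within A, continuous (h \o f)}.
Proof.
move=> /subspace_continuousP cf AB /subspace_continuousP ch.
apply/subspace_continuousP => x Ax.
apply: (@cvg_comp _ _ _ f h _ (within B (nbhs (f x)))); last exact/ch/AB.
move=> P /= hP; have := cf x Ax _ hP.
by rewrite /nbhs/= /within/=; apply: filterS => y Py Ay; exact/Py/AB.
Qed.

Lemma cvg_pair_nbhs {S : Type} {T U : topologicalType} (F : set_system S)
    {FF : Filter F} (f : S -> T) (g : S -> U) (a : T) (b : U) :
  f x @[x --> F] --> a -> g x @[x --> F] --> b ->
  (f x, g x) @[x --> F] --> (a, b).
Proof. by move=> fa gb; exact: (cvg_pair fa gb). Qed.

Lemma homeomorphism_comp {S T U : topologicalType} (f : S -> T) (g : T -> U) :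
  homeomorphism f -> homeomorphism g -> homeomorphism (g \o f).
Proof.
move=> [f' [fK f'K cf cf']] [g' [gK g'K cg cg']].
exists (f' \o g'); split.
- by move=> x /=; rewrite gK fK.
- by move=> x /=; rewrite f'K g'K.
- by move=> x; apply: continuous_comp; [exact: cf|exact: cg].
- by move=> x; apply: continuous_comp; [exact: cg'|exact: cf'].
Qed.

Section AmbientIsotopy.
Context {R : realType} {n : nat}.
Implicit Types A B C : set 'rV[R]_n.

Let I01 : set (R * 'rV[R]_n) := `[0, 1] `*` setT.

(** The isotopy runs backwards after its last stage is undone. Only the inverse of the stage at time
    1 enters, so inverses need not be continuous jointly in time. *)
Lemma ambient_isotopic_sym A B : ambient_isotopic A B -> ambient_isotopic B A.
Proof.
move=> [H [cH H0 hH HAB]].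
have [f' [fK f'K cf cf']] := hH 1 ltac:(by rewrite in_itv/= ler01 lexx).
exists (fun tx => H (1 - tx.1, f' tx.2)); split => [|x|t t01|].
- apply: (@continuous_within_comp _ _ _ I01 I01
    (fun tx => (1 - tx.1, f' tx.2)) H) => //.
    apply: continuous_subspaceT => -[t x].
    apply: (@cvg_pair_nbhs _ _ _ (nbhs (t, x)) _ (fun tx => 1 - tx.1)
      (fun tx => f' tx.2) (1 - t) (f' x)) => /=.
      by apply: cvgB; [exact: cvg_cst|exact: cvg_fst].
    apply: (@cvg_comp _ _ _ snd f'); first exact: cvg_snd.
    exact: cf'.
  move=> [t x] [/= t01 _]; split => //=.
  by move: t01; rewrite !in_itv/= => /andP[t0 t1]; lra.
- by rewrite subr0 f'K.
- apply: (@homeomorphism_comp _ _ _ f' (fun x => H (1 - t, x))).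
    by exists (fun x => H (1, x)).
  apply: hH.
  by move: t01; rewrite !in_itv/= => /andP[t0 t1]; lra.
- rewrite -HAB; apply/seteqP; split => [_ [_ [x Ax <-] <-]|x Ax] /=.
    by rewrite subrr fK H0.
  by exists (H (1, x)); [exists x|rewrite /= subrr fK H0].
Qed.

(** Both isotopies run simultaneously, so nothing has to be glued in time. *)
Lemma ambient_isotopic_trans A B C :
  ambient_isotopic A B -> ambient_isotopic B C -> ambient_isotopic A C.
Proof.
move=> [H [cH H0 hH <-]] [K [cK K0 hK <-]].
exists (fun tx => K (tx.1, H tx)); split => [|x|t t01|].
- apply: (@continuous_within_comp _ _ _ I01 I01 (fun tx => (tx.1, H tx)) K) => //.
  move/subspace_continuousP : cH => cH; apply/subspace_continuousP => tx Atx.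
    apply: (@cvg_pair_nbhs _ _ _ (within I01 (nbhs tx)) _ fst H tx.1 (H tx));
      last exact: cH.
    by apply: cvg_within_filter; case: tx {Atx} => t x; exact: cvg_fst.
- by rewrite /= H0 K0.
- exact: (homeomorphism_comp (hH t t01) (hK t t01)).
- by rewrite image_comp.
Qed.

End AmbientIsotopy.

(** * Lipschitz perturbations of the identity *)

(** The extension is the infimum of the cones [D s + k * |x - c s|]. Indexing the data by [S] avoids
    inverting [c]: the hypothesis forces [D] to factor through [c]. *)
Lemma mcshane_extension {R : realType} {V : normedModType R} (S : choiceType)
    (s0 : S) (c : S -> V) (D : S -> R) (k : R) : 0 <= k ->
  (forall s t, `|D s - D t| <= k * `|c s - c t|) ->
  exists F : V -> R, (forall s, F (c s) = D s) /\
    forall x y, `|F x - F y| <= k * `|x - y|.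
Proof.
move=> k0 Dk; pose E x := [set D s + k * `|x - c s| | s in [set: S]].
have E_lb s x : lbound (E x) (D s - k * `|x - c s|).
  move=> _ [t _ <-]; have := Dk s t; rewrite ler_norml => /andP[_].
  have := ler_wpM2l k0 (ler_distD x (c s) (c t)).
  rewrite mulrDr (distrC (c s) x); lra.
have E_neq0 x : E x !=set0 by exists (D s0 + k * `|x - c s0|); exists s0.
have E_hlb x : has_lbound (E x) by exists (D s0 - k * `|x - c s0|); exact: E_lb.
exists (inf \o E); split => [s|x y] /=.
  apply/eqP; rewrite eq_le; apply/andP; split.
    apply: ge_inf; first exact: E_hlb.
    by exists s => //; rewrite subrr normr0 mulr0 addr0.
  apply: lb_le_inf => //.
  by have := E_lb s (c s); rewrite subrr normr0 mulr0 subr0.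
have half x' y' : inf (E x') - inf (E y') <= k * `|x' - y'|.
  rewrite lerBlDl -lerBlDr; apply: lb_le_inf => // _ [s _ <-].
  rewrite lerBlDr; apply: (@le_trans _ _ (D s + k * `|x' - c s|)).
    by apply: ge_inf; [exact: E_hlb|exists s].
  by rewrite -addrA lerD2l -mulrDr ler_wpM2l// [leRHS]addrC ler_distD.
by rewrite ler_norml half andbT lerNl opprB distrC half.
Qed.

HB.instance Definition _ (R : realType) (m n : nat) :=
  Uniform_isComplete.Build 'M[R]_(m, n) cauchy_cvg.

Lemma lipschitz_continuous {R : realType} {V W : normedModType R} (F : V -> W)
    (k : R) :
  (forall x y, `|F x - F y| <= k * `|x - y|) -> continuous F.
Proof.
move=> Fk x; apply/cvgrPdist_le => e e0; near=> y.
have k1 : 0 < `|k| + 1 by rewrite ltr_wpDl.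
apply: (le_trans (Fk x y)).
apply: (@le_trans _ _ ((`|k| + 1) * `|x - y|)).
  by rewrite ler_wpM2r// (le_trans (ler_norm k))// lerDl.
rewrite mulrC -ler_pdivlMr//.
near: y; apply: (@cvgr_dist_le _ _ _ (nbhs x) _ id x) => //.
by rewrite divr_gt0.
Unshelve. all: by end_near. Qed.

Section LipschitzPerturbation.
Context {R : realType} {n : nat}.
Implicit Types (F : 'rV[R]_n -> 'rV[R]_n) (k : R).

(** A preimage of [y] is a fixed point of the contraction [x |-> y - F x]; the estimate [expand]
    gives injectivity and a Lipschitz inverse. *)
Lemma perturbation_homeomorphism F k : 0 <= k < 1 ->
  (forall x y, `|F x - F y| <= k * `|x - y|) ->
  homeomorphism (fun x : 'rV[R]_n => x + F x).
Proof.
move=> /andP[k0 k1] Fk.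
have surj y : exists x, x + F x = y.
  pose X : completeNormedModType R := 'rV[R]_n.
  pose g (x : X) : X := y - F x.
  have gT : {homo g : x / [set: X] x >-> [set: X] x} by [].
  have [|||p _ pE] := @banach_fixed_point R X setT (mkfun_fun gT).
  - exists (NngNum k0); split => // -[a b] _ /=.
    by rewrite /= /mkfun/g opprB addrC subrKA distrC.
  - exact: closedT.
  - by exists 0.
  by exists p; rewrite {1}pE /= subrK.
have expand x y : (1 - k) * `|x - y| <= `|(x + F x) - (y + F y)|.
  have -> : x + F x - (y + F y) = (x - y) - (F y - F x).
    by rewrite opprD opprB addrACA.
  apply: le_trans (lerB_dist _ _).
  have := Fk y x; rewrite (distrC y x); lra.
have [f' f'K] := choice surj.
have fK : cancel (fun x => x + F x) f'.
  move=> x; apply/eqP; rewrite -subr_eq0 -normr_le0.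
  have := expand (f' (x + F x)) x.
  by rewrite f'K subrr normr0 pmulr_rle0// subr_gt0.
exists f'; split => //.
- apply: (@lipschitz_continuous _ _ _ _ (1 + k)) => x y.
  by rewrite opprD addrACA (le_trans (ler_normD _ _))// mulrDl mul1r lerD2l.
- apply: (@lipschitz_continuous _ _ _ _ (1 - k)^-1) => x y.
  by rewrite ler_pdivlMl ?subr_gt0// (le_trans (expand _ _))// !f'K.
Qed.

(** In the maximum norm each coordinate of the displacement extends with the constant 1/2 and so
    does the whole; multiplying by a time in [0, 1] does not increase it. *)
Lemma lipschitz_close_isotopic (S : choiceType) (s0 : S) (c c' : S -> 'rV[R]_n) :
  (forall s t, `|(c' s - c s) - (c' t - c t)| <= 2^-1 * `|c s - c t|) ->
  ambient_isotopic (range c) (range c').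
Proof.
move=> cc'.
have ext i : exists F : 'rV[R]_n -> R,
    (forall s, F (c s) = (c' s - c s) ord0 i) /\
    forall x y, `|F x - F y| <= 2^-1 * `|x - y|.
  apply: (mcshane_extension s0) => // s t; apply: le_trans (cc' s t).
  by have := coord_le_norm (c' s - c s - (c' t - c t)) i; rewrite !mxE.
have [F0 F0P] := choice ext; pose F x : 'rV[R]_n := \row_i F0 i x.
have Fk x y : `|F x - F y| <= 2^-1 * `|x - y|.
  by apply: norm_le_coord => [|i]; rewrite ?mulr_ge0// !mxE; have [_] := F0P i.
have Fc s : c s + F (c s) = c' s.
  apply/rowP => i; rewrite mxE [F _ _ _]mxE; have [-> _] := F0P i.
  by rewrite !mxE addrC subrK.
exists (fun tx => tx.2 + tx.1 *: F tx.2); split => [|x|t|].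
- apply: continuous_subspaceT => -[t x] /=.
  apply: cvgD; first exact: cvg_snd.
  apply: cvgZ; first exact: cvg_fst.
  apply: (@cvg_comp _ _ _ snd F); first exact: cvg_snd.
  exact: (lipschitz_continuous Fk).
- by rewrite /= scale0r addr0.
- rewrite in_itv/= => /andP[t0 t1].
  apply: (@perturbation_homeomorphism (fun x => t *: F x) 2^-1); first by lra.
  move=> x y; rewrite -scalerBr normrZ ger0_norm//.
  by apply: le_trans (Fk x y); rewrite ler_piMl.
- apply/seteqP; split => [_ [_ [s _ <-] <-]|_ [s _ <-]] /=.
    by rewrite scale1r Fc; exists s.
  by exists (c s); [exists s|rewrite /= scale1r Fc].
Qed.

End LipschitzPerturbation.

(** * Lower bounds for integrals without measurability of the integrand *)

Section LowerIntegralBound.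
Local Open Scope ereal_scope.
Context {d : measure_display} {T : measurableType d} {R : realType}.
Variable mu : {measure set T -> \bar R}.

(* The integral of a nonnegative function, measurable or not, is a supremum
   over simple functions. *)
Lemma le_integral_restrict (I D : set T) (f1 f2 : T -> \bar R) : I `<=` D ->
  (forall x, I x -> 0 <= f1 x) -> (forall x, D x -> 0 <= f2 x) ->
  (forall x, I x -> f1 x <= f2 x) ->
  \int[mu]_(x in I) f1 x <= \int[mu]_(x in D) f2 x.
Proof.
move=> ID f10 f20 f12; rewrite !ge0_integralE//.
apply: ereal_sup_le => _ [h hf <-]; exists h => // x.
apply: le_trans (hf x) _; rewrite /patch.
case: ifPn => [/set_mem Ix|_]; first by rewrite mem_set ?f12//; exact: ID.
by case: ifPn => // /set_mem; exact: f20.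
Qed.

(** [F] will itself be an integral, with no measurability established; the bound therefore passes
    through the measurable weight [k * v] on [I]. *)
Lemma integral_ge_scaled (I D : set T) (F : T -> \bar R) (v : T -> R) (k r : R) :
  measurable I -> I `<=` D -> measurable_fun I v -> (0 <= k)%R ->
  (forall x, I x -> 0 <= v x)%R -> (forall x, D x -> 0 <= F x) ->
  (forall x, I x -> (k * v x)%:E <= F x) ->
  r%:E <= \int[mu]_(x in I) (v x)%:E -> (k * r)%:E <= \int[mu]_(x in D) F x.
Proof.
move=> mI ID mv k0 v0 F0 kvF rv.
apply: (@le_trans _ _ (\int[mu]_(x in I) (k * v x)%:E)); last first.
  by apply: le_integral_restrict => // x Ix; rewrite lee_fin mulr_ge0// v0.
under eq_integral do rewrite EFinM.
rewrite ge0_integralZl_EFin//.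
  by rewrite EFinM lee_wpmul2l// lee_fin.
exact/measurable_EFinP.
Qed.

End LowerIntegralBound.

(** * Hitting times of levels, and continuity along a curve *)

Section FirstHit.
Context {R : realType}.
Implicit Types f : R -> R.

Lemma ivt_le f (a b y : R) : continuous f -> a <= b -> f a <= y <= f b ->
  exists2 c, a <= c <= b & f c = y.
Proof.
move=> cf ab fy.
have [|c] := @IVT _ f a b y ab (continuous_subspaceT cf).
  move: fy => /andP[fay yfb].
  by have fab := le_trans fay yfb; rewrite min_l// max_r// fay.
by rewrite in_itv/=; exists c.
Qed.

Lemma first_hit f (a b y : R) : continuous f -> a <= b -> f a <= y <= f b ->
  exists2 c, a <= c <= b & f c = y /\ forall t, a <= t <= c -> f t <= y.
Proof.
move=> cf ab /andP[fay yfb].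
pose Z := [set t | a <= t <= b /\ y <= f t].
have Zb : Z b by split; rewrite ?ab ?lexx.
have Zlb : lbound Z a by move=> t [/andP[]].
have hZ : has_lbound Z by exists a.
pose c := inf Z.
have ac : a <= c by apply: lb_le_inf => //; exists b.
have cb : c <= b by exact: ge_inf.
have below t : a <= t -> t < c -> f t < y.
  move=> at_ tc; rewrite ltNge; apply/negP => yft.
  have : c <= t by apply: ge_inf => //; split => //; rewrite at_ (le_trans (ltW tc)).
  by rewrite leNgt tc.
have yfc : y <= f c.
  rewrite leNgt; apply/negP => fcy.
  have /nbhs_ballP[e /= e0 He] : \forall x \near c, f x < y.
    exact: cvgr_lt (cf c) _ fcy.
  have : c + e / 2 <= c.
    apply: lb_le_inf => [|t [/andP[at_ tb] yft]]; first by exists b.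
    rewrite leNgt; apply/negP => tc.
    have ct : c <= t by apply: ge_inf => //; split => //; rewrite at_.
    have : f t < y.
      apply: He; rewrite /ball/= distrC ger0_norm ?subr_ge0//.
      by rewrite ltrBlDl (lt_le_trans tc)// lerD2l; lra.
    by rewrite ltNge yft.
  by rewrite gerDl leNgt divr_gt0.
have [c' /andP[ac' c'c] fc'] : exists2 c', a <= c' <= c & f c' = y.
  by apply: ivt_le => //; rewrite fay.
have c'E : c' = c.
  apply/eqP; rewrite eq_le c'c/= leNgt; apply/negP => c'c2.
  by have := below c' ac' c'c2; rewrite fc' ltxx.
exists c; first by rewrite ac.
split => [|t /andP[at_]]; first by rewrite -c'E.
by rewrite le_eqVlt => /predU1P[->|/(below _ at_)/ltW//]; rewrite -fc' c'E.
Qed.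

Lemma last_hit f (a b y : R) : continuous f -> a <= b -> f b <= y <= f a ->
  exists2 c, a <= c <= b & f c = y /\ forall t, c <= t <= b -> f t <= y.
Proof.
move=> cf ab fy.
have [|||c /andP[bc ca] [fc Hc]] := @first_hit (f \o -%R) (- b) (- a) y.
- move=> x; apply: continuous_comp; first exact: opp_continuous.
  exact: cf.
- by rewrite lerN2.
- by rewrite /= !opprK.
exists (- c); first by rewrite lerNr ca lerNl bc.
split => // t /andP[ct tb].
have := Hc (- t); rewrite /= opprK; apply.
by rewrite lerN2 tb lerNl ct.
Qed.

End FirstHit.

Section CurveContinuity.
Context {R : realType} {n : nat}.
Implicit Types (g : R -> 'rV[R]_n) (x e : 'rV[R]_n).

Lemma enorm_dist_continuous g x : continuous g ->
  continuous (fun t => enorm (g t - x)).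
Proof.
move=> cg t.
apply: (@continuous_comp _ _ _ g (fun y => enorm (y - x))); first exact: cg.
apply: (@lipschitz_continuous _ _ _ _ n%:R) => y z.
apply: le_trans (enorm_le_norm _).
rewrite ler_norml lerBlDr enorm_distD andbT lerNl opprB lerBlDr.
by rewrite (enorm_distC y z) enorm_distD.
Qed.

Lemma dotp_continuous g e : continuous g -> continuous (fun t => dotp (g t) e).
Proof.
move=> cg t.
apply: (@continuous_comp _ _ _ g (fun y => dotp y e)); first exact: cg.
apply: (@lipschitz_continuous _ _ _ _ (n%:R * enorm e)) => y z.
rewrite -dotpBl (le_trans (dotp_le_enorm _ _))// mulrC.
by rewrite (mulrC n%:R) -mulrA ler_wpM2l ?enorm_ge0// enorm_le_norm.
Qed.

End CurveContinuity.

(** * The energy bounds the area of triangles *)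

Section EnergyBound.
Context {R : realType} {n : nat}.
Implicit Types (g : R -> 'rV[R]_n) (v : R -> R).

Let mu := @lebesgue_measure R.

(** The speed of a Sobolev curve is controlled almost everywhere only, and [derive1] takes default
    values elsewhere. The energy estimate works with a measurable [v] below the speed that still
    carries the chords, up to the factor lost by arguing in coordinates. *)
Definition speed_minorant g v : Prop :=
  [/\ measurable_fun setT v, (forall t, 0 <= v t <= enorm (derive1 g t)) &
    forall a b, 0 <= a -> a <= b -> b <= 1 ->
      ((enorm (g b - g a) / n.+1%:R)%:E <= \int[mu]_(t in `[a, b]) (v t)%:E)%E].

Lemma menger_integrand_ge0 (p q : R) (x y z : 'rV[R]_n) :
  0 <= menger_integrand p q x y z.
Proof. by rewrite /menger_integrand divr_ge0 ?powR_ge0. Qed.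

Lemma energy_ge (p q m r : R) g v (a1 b1 a2 b2 a3 b3 : R) :
  speed_minorant g v -> 0 <= m -> 0 <= r ->
  0 <= a1 -> b1 <= 1 -> 0 <= a2 -> b2 <= 1 -> 0 <= a3 -> b3 <= 1 ->
  (forall u1 u2 u3, u1 \in `[a1, b1] -> u2 \in `[a2, b2] -> u3 \in `[a3, b3] ->
    m <= menger_integrand p q (g u1) (g u2) (g u3)) ->
  (r%:E <= \int[mu]_(t in `[a1, b1]) (v t)%:E)%E ->
  (r%:E <= \int[mu]_(t in `[a2, b2]) (v t)%:E)%E ->
  (r%:E <= \int[mu]_(t in `[a3, b3]) (v t)%:E)%E ->
  ((m * r * r * r)%:E <= intM p q g)%E.
Proof.
move=> [mv v_le _] m0 r0 a10 b11 a20 b21 a30 b31 mm r1 r2 r3.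
have v0 t : 0 <= v t by have /andP[] := v_le t.
have vle t : v t <= enorm (derive1 g t) by have /andP[] := v_le t.
have sub a b : 0 <= a -> b <= 1 -> [set` `[a, b]] `<=` [set` `[0, 1]].
  move=> a0 b01 t /=; rewrite !in_itv/= => /andP[at_ tb].
  by rewrite (le_trans a0 at_) (le_trans tb b01).
have F0 u1 u2 u3 : 0 <= menger_integrand p q (g u1) (g u2) (g u3) *
    enorm (derive1 g u1) * enorm (derive1 g u2) * enorm (derive1 g u3).
  by do 3?[apply: mulr_ge0; last exact: enorm_ge0]; exact: menger_integrand_ge0.
have mvI (I : set R) : measurable_fun I v by exact: measurable_funS mv.
rewrite /intM.
apply: (@integral_ge_scaled _ _ R mu `[a1, b1]%classic `[0, 1]%classic _ v) => //.
- exact: sub.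
- exact: mvI.
- by rewrite !mulr_ge0.
- move=> u1 _; apply: integral_ge0 => u2 _; apply: integral_ge0 => u3 _.
  by rewrite lee_fin F0.
move=> u1 u1I.
rewrite (_ : m * r * r * v u1 = m * v u1 * r * r); last by ring.
apply: (@integral_ge_scaled _ _ R mu `[a2, b2]%classic `[0, 1]%classic _ v) => //.
- exact: sub.
- exact: mvI.
- by rewrite !mulr_ge0.
- move=> u2 _; apply: integral_ge0 => u3 _.
  by rewrite lee_fin F0.
move=> u2 u2I.
rewrite (_ : m * v u1 * r * v u2 = m * v u1 * v u2 * r); last by ring.
apply: (@integral_ge_scaled _ _ R mu `[a3, b3]%classic `[0, 1]%classic _ v) => //.
- exact: sub.
- exact: mvI.
- by rewrite !mulr_ge0.
- by move=> u3 _; rewrite lee_fin F0.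
move=> u3 u3I; rewrite lee_fin.
by do 3?[apply: ler_pM; rewrite ?mulr_ge0//]; exact: mm.
Qed.

(** The arc runs from [u] towards [w], possibly backwards, until it first reaches distance [r]: it
    stays in the ball, its chord has length [r], and it does not leave [[0, 1]]. *)
Lemma short_arc g v (u w r : R) : continuous g -> speed_minorant g v ->
  0 <= u <= 1 -> 0 <= w <= 1 -> 0 <= r <= enorm (g w - g u) ->
  exists a b : R, [/\ 0 <= a, b <= 1,
    (forall t, t \in `[a, b] -> enorm (g t - g u) <= r) &
    ((r / n.+1%:R)%:E <= \int[mu]_(t in `[a, b]) (v t)%:E)%E].
Proof.
move=> cg [_ _ sp] /andP[u0 u1] /andP[w0 w1] /andP[r0 rw].
have cf := enorm_dist_continuous (x := g u) cg.
have [uw|/ltW wu] := leP u w.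
  have [|c /andP[uc cw] [fc Hc]] := first_hit (y := r) cf uw.
    by rewrite subrr enorm0 r0.
  exists u, c; split => //.
  - exact: le_trans w1.
  - by rewrite -fc; apply: sp => //; exact: le_trans w1.
have [|c /andP[wc cu] [fc Hc]] := last_hit (y := r) cf wu.
  by rewrite subrr enorm0 r0.
exists c, u; split => //.
- exact: le_trans wc.
- by rewrite -fc enorm_distC; apply: sp => //; exact: le_trans wc.
Qed.

(** Each edge vector moves by at most [2 * s]. Replacing the second edge costs [r * (2 * s)], then
    the first [(2 * s) * (2 * r)], the new second edge being at most [2 * r] since [s <= r / 2]. *)
Lemma wedge_perturb (x y z x' y' z' : 'rV[R]_n) (r s : R) :
  s <= r / 2 -> enorm (x' - x) <= s -> enorm (y' - y) <= s ->
  enorm (z' - z) <= s -> enorm (y - x) <= r -> enorm (z - x) <= r ->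
  wedge_norm (y - x) (z - x) <= wedge_norm (y' - x') (z' - x') + 6 * r * s.
Proof.
move=> sr xx yy zz yx zx.
have r0 : 0 <= r by rewrite (le_trans (enorm_ge0 _) yx).
have s0 : 0 <= s by rewrite (le_trans (enorm_ge0 _) xx).
have shift (a a' : 'rV[R]_n) : enorm (a' - a) <= s ->
    enorm ((a - x) - (a' - x')) <= 2 * s.
  move=> aa.
  have -> : a - x - (a' - x') = (x' - x) - (a' - a).
    by apply/rowP => i; rewrite !mxE; ring.
  by rewrite (le_trans (enormD _ _))// enormN mulr_natl mulr2n lerD.
have zx' : enorm (z' - x') <= 2 * r.
  have -> : z' - x' = (z - x) - ((z - x) - (z' - x')) by rewrite subKr.
  rewrite (le_trans (enormD _ _))// enormN.
  have := shift _ _ zz; lra.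
have w1 : wedge_norm (y - x) (z - x) <=
    wedge_norm (y - x) (z' - x') + r * (2 * s).
  have {1}-> : z - x = (z' - x') + ((z - x) - (z' - x')) by rewrite [RHS]addrC subrK.
  rewrite (le_trans (wedgeDr _ _ _))//.
  rewrite lerD2l (le_trans (wedge_le _ _))// ler_pM ?enorm_ge0//.
  exact: shift.
have w2 : wedge_norm (y - x) (z' - x') <=
    wedge_norm (y' - x') (z' - x') + (2 * s) * (2 * r).
  have {1}-> : y - x = (y' - x') + ((y - x) - (y' - x')) by rewrite [RHS]addrC subrK.
  rewrite (le_trans (wedgeDl _ _ _))//.
  rewrite lerD2l (le_trans (wedge_le _ _))// ler_pM ?enorm_ge0//.
  exact: shift.
lra.
Qed.

(** A positive area keeps the three points distinct, so the default value of the quotient at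
    coincident points does not occur. *)
Lemma menger_integrand_ge (p q r W : R) (x y z : 'rV[R]_n) :
  0 <= p -> 0 <= q -> 0 < W -> W <= wedge_norm (y - x) (z - x) ->
  enorm (y - x) <= r -> enorm (z - x) <= r -> enorm (y - z) <= r ->
  W `^ q / (r ^+ 3) `^ p <= menger_integrand p q x y z.
Proof.
move=> p0 q0 W0 Ww yx zx yz.
have w0 : 0 < wedge_norm (y - x) (z - x) by exact: lt_le_trans Ww.
have yx0 : 0 < enorm (y - x).
  rewrite enorm_gt0; apply: contraTneq w0 => ->.
  by rewrite wedge0l ltxx.
have zx0 : 0 < enorm (z - x).
  rewrite enorm_gt0; apply: contraTneq w0 => ->.
  by rewrite wedge0r ltxx.
have yz0 : 0 < enorm (y - z).
  rewrite enorm_gt0 subr_eq0; apply: contraTneq w0 => ->.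
  by rewrite wedgexx ltxx.
have r0 : 0 < r by exact: lt_le_trans yx.
rewrite /menger_integrand ler_pM ?powR_ge0 ?invr_ge0 ?powR_ge0//.
  by rewrite ge0_ler_powR ?nnegrE// ltW.
rewrite lef_pV2 ?posrE ?powR_gt0 ?mulr_gt0 ?exprn_gt0//.
rewrite ge0_ler_powR ?nnegrE ?mulr_ge0 ?exprn_ge0 ?enorm_ge0 ?(ltW r0)//.
by rewrite !exprS expr0 mulr1 mulrA !ler_pM ?mulr_ge0 ?enorm_ge0.
Qed.

Lemma wedge_le_energy (p q E : R) : 1 < q -> 0 < p -> 0 < E ->
  exists2 A : R, 0 <= A & forall g v, continuous g -> speed_minorant g v ->
    (intM p q g <= E%:E)%E ->
    forall u1 u2 u3 r : R, 0 <= u1 <= 1 -> 0 <= u2 <= 1 -> 0 <= u3 <= 1 ->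
    0 < r -> enorm (g u2 - g u1) <= r -> enorm (g u3 - g u1) <= r ->
    enorm (g u2 - g u3) <= r ->
    wedge_norm (g u2 - g u1) (g u3 - g u1) <=
      A * r `^ ((3 * p - 3 - 2 * q) / (q + 3)) * r ^+ 2.
Proof.
move=> q1 p0 E0; set k := _ / _.
have q0 : 0 < q by exact: lt_trans q1.
have q3 : 0 < q + 3 by rewrite addr_gt0.
pose K : R := 24 * n.+1%:R.
have K0 : 0 < K by rewrite mulr_gt0.
pose C := 2 `^ q * 8 `^ p * K ^+ 3.
have C0 : 0 < C by rewrite !mulr_gt0 ?powR_gt0 ?exprn_gt0.
exists ((E * C) `^ (q + 3)^-1); first exact: powR_ge0.
move=> g v cg gv gE u1 u2 u3 r u1I u2I u3I r0 xy xz yz.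
set x := g u1 in xy xz *; set y := g u2 in xy yz *; set z := g u3 in xz yz *.
set W := wedge_norm _ _; rewrite leNgt; apply/negP => AW.
have W0 : 0 < W.
  by apply: le_lt_trans AW; rewrite !mulr_ge0 ?powR_ge0 ?(ltW r0).
have Wxy : W <= enorm (y - x) * r.
  by rewrite (le_trans (wedge_le _ _))// ler_wpM2l ?enorm_ge0.
have Wxz : W <= enorm (z - x) * r.
  by rewrite (le_trans (wedge_le _ _))// mulrC ler_wpM2l ?enorm_ge0.
have Wrr : W <= r * r by rewrite (le_trans Wxy)// ler_wpM2r// ltW.
(* Since [6 * r * s = W / 4], the area stays above [W / 2] when the points move by [s]; and [W] is
   at most [r] times each edge at [x], so [s] is below these edges and [short_arc] applies. *)
pose s := W / (24 * r).
have s0 : 0 < s by rewrite divr_gt0 ?mulr_gt0.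
have sE : s * (24 * r) = W by rewrite /s divfK// gt_eqF// mulr_gt0.
have sr : s <= r / 2.
  rewrite -(ler_pM2r (_ : 0 < 24 * r)) ?mulr_gt0// sE (le_trans Wrr)//.
  by rewrite (_ : r / 2 * (24 * r) = 12 * (r * r)); [nra|field].
have sxy : s <= enorm (y - x).
  rewrite -(ler_pM2r (_ : 0 < 24 * r)) ?mulr_gt0// sE (le_trans Wxy)//.
  by rewrite ler_wpM2l ?enorm_ge0//; lra.
have sxz : s <= enorm (z - x).
  rewrite -(ler_pM2r (_ : 0 < 24 * r)) ?mulr_gt0// sE (le_trans Wxz)//.
  by rewrite ler_wpM2l ?enorm_ge0//; lra.
have [|a1 [b1 [a10 b11 H1 I1]]] := @short_arc g v u1 u2 s cg gv u1I u2I.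
  by rewrite (ltW s0).
have [|a2 [b2 [a20 b21 H2 I2]]] := @short_arc g v u2 u1 s cg gv u2I u1I.
  by rewrite (ltW s0) enorm_distC.
have [|a3 [b3 [a30 b31 H3 I3]]] := @short_arc g v u3 u1 s cg gv u3I u1I.
  by rewrite (ltW s0) enorm_distC.
pose m := (W / 2) `^ q / ((2 * r) ^+ 3) `^ p.
have m0 : 0 <= m by rewrite divr_ge0 ?powR_ge0.
have near_le (a b a' b' : 'rV[R]_n) : enorm (a - b) <= r ->
    enorm (a' - a) <= s -> enorm (b' - b) <= s -> enorm (a' - b') <= 2 * r.
  move=> ab aa bb.
  have := enorm_distD a a' b'; have := enorm_distD b a b'.
  rewrite (enorm_distC b); lra.
have mM t1 t2 t3 : t1 \in `[a1, b1] -> t2 \in `[a2, b2] -> t3 \in `[a3, b3] ->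
    m <= menger_integrand p q (g t1) (g t2) (g t3).
  move=> t1I t2I t3I.
  have h1 := H1 _ t1I; have h2 := H2 _ t2I; have h3 := H3 _ t3I.
  apply: menger_integrand_ge.
  - exact: ltW.
  - exact: ltW.
  - by rewrite divr_gt0.
  - have := wedge_perturb sr h1 h2 h3 xy xz; rewrite -/W -/x -/y -/z.
    have : 6 * r * s = W / 4 by rewrite -sE; field.
    by move=> ->; lra.
  - exact: near_le xy h2 h1.
  - exact: near_le xz h3 h1.
  - exact: near_le yz h2 h3.
have sn0 : 0 <= s / n.+1%:R by rewrite divr_ge0// ltW.
have := le_trans (energy_ge gv m0 sn0 a10 b11 a20 b21 a30 b31 mM I1 I2 I3) gE.
rewrite lee_fin leNgt => /negP; apply.
(* The assumption raised to the power q + 3, where (k + 2)(q + 3) = 3 p + 3. The three arcs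
   contribute exactly W^(q + 3) / (C r^(3 p + 3)), which then exceeds [E]. *)
have {}AW : E * C * (r `^ (3 * p) * r ^+ 3) < W `^ q * W ^+ 3.
  have -> : W `^ q * W ^+ 3 = W `^ (q + 3).
    by rewrite -powR_mulrn ?(ltW W0)// -powRD// (gt_eqF W0) implybT.
  have -> : E * C * (r `^ (3 * p) * r ^+ 3) =
      ((E * C) `^ (q + 3)^-1 * r `^ k * r ^+ 2) `^ (q + 3).
    have rn0 : r != 0 by rewrite gt_eqF.
    move: (E * C) (mulr_gt0 E0 C0) => D D0.
    rewrite !powRM ?mulr_ge0 ?powR_ge0 ?exprn_ge0 ?(ltW r0)//.
    rewrite -[D `^ _ `^ _]powRrM mulVf ?gt_eqF// powRr1 ?(ltW D0)//.
    rewrite -!mulrA -!powR_mulrn ?(ltW r0)// -!powRrM -!powRD ?rn0 ?implybT//.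
    congr (_ * _); congr (_ `^ _); rewrite /k; field.
    by rewrite gt_eqF.
  by apply: gt0_ltr_powR; rewrite ?nnegrE ?mulr_ge0 ?powR_ge0 ?(ltW r0) ?(ltW W0).
have P0 : 0 < C * (r `^ (3 * p) * r ^+ 3).
  by rewrite !mulr_gt0 ?powR_gt0 ?exprn_gt0.
rewrite -(ltr_pM2r P0) [ltLHS]mulrA; apply: lt_le_trans AW _.
rewrite /m /s (@powRM _ W 2^-1 q)// ?(ltW W0)//.
have -> : ((2 * r) ^+ 3) `^ p = 8 `^ p * r `^ (3 * p).
  rewrite exprMn powRM ?exprn_ge0 ?(ltW r0)// powRrM powR_mulrn ?(ltW r0)//.
  by congr (_ `^ _ * _); rewrite -natrX.
have -> : 2^-1 `^ q = (2 `^ q)^-1 :> R.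
  by rewrite -powRN -(mulN1r q) powRrM powR_inv1.
have b0 : 2 `^ q != 0 :> R by rewrite gt_eqF ?powR_gt0.
have c0 : 8 `^ p != 0 :> R by rewrite gt_eqF ?powR_gt0.
have d0 : r `^ (3 * p) != 0 by rewrite gt_eqF ?powR_gt0.
have n0 : n.+1%:R != 0 :> R by rewrite pnatr_eq0.
rewrite /C /K le_eqVlt; apply/orP; left; apply/eqP; field.
by rewrite b0 c0 d0 (gt_eqF r0) addrC natr1 n0.
Qed.

End EnergyBound.

(** * Directions of secants of a flat connected set *)

(** The geometric series of ratio 2^(-k) sums the turning over dyadic scales, [32 * A] covers two
    angles at a single scale, and the outer 2 stands for two secants compared with a third. *)
Definition secant_constant {R : realType} (A k : R) : R :=
  2 * (16 * A * 4 `^ k / (1 - 2^-1 `^ k) + 32 * A).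

Section SecantDirections.
Context {R : realType} {n : nat}.
Variables (G : set 'rV[R]_n) (A k : R).
Hypotheses (A0 : 0 <= A) (k0 : 0 < k).
Hypothesis G_flat : forall x y z r, G x -> G y -> G z -> 0 < r ->
  enorm (y - x) <= r -> enorm (z - x) <= r -> enorm (y - z) <= r ->
  wedge_norm (y - x) (z - x) <= A * r `^ k * r ^+ 2.
Hypothesis G_connected : forall x w d, G x -> G w ->
  0 <= d <= enorm (w - x) -> exists2 z, G z & enorm (z - x) = d.

Implicit Types a b v w x y z : 'rV[R]_n.

Let parallel (d : R) v w := wedge_norm v w <= d * (enorm v * enorm w).

Let parallelW d d' v w : d <= d' -> parallel d v w -> parallel d' v w.
Proof.
move=> dd' /le_trans; apply; apply: ler_wpM2r => //.
by rewrite mulr_ge0 ?enorm_ge0.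
Qed.

Let powk_le (x y : R) : 0 <= x -> x <= y -> x `^ k <= y `^ k.
Proof.
move=> x0 xy; rewrite ge0_ler_powR ?nnegrE ?(ltW k0)//.
exact: le_trans xy.
Qed.

Let angle_at x y z r : G x -> G y -> G z -> 0 < r ->
  r / 4 <= enorm (y - x) <= r -> r / 4 <= enorm (z - x) <= r ->
  enorm (y - z) <= r -> parallel (16 * A * r `^ k) (y - x) (z - x).
Proof.
move=> Gx Gy Gz r0 /andP[y1 y2] /andP[z1 z2] yz.
apply: le_trans (G_flat Gx Gy Gz r0 y2 z2 yz) _.
have -> : 16 * A * r `^ k * (enorm (y - x) * enorm (z - x)) =
    A * r `^ k * (16 * (enorm (y - x) * enorm (z - x))) by ring.
rewrite ler_wpM2l ?mulr_ge0 ?powR_ge0//.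
have -> : r ^+ 2 = 16 * (r / 4 * (r / 4)) by field.
by rewrite ler_wpM2l// ler_pM// divr_ge0// ltW.
Qed.

Let theta : R := 2^-1 `^ k.

Let theta_gt0 : 0 < theta. Proof. by rewrite powR_gt0. Qed.

Let theta_lt1 : theta < 1.
Proof.
have := @gt0_ltr_powR R k k0 2^-1 1; rewrite powR1; apply; rewrite ?nnegrE//.
by rewrite invf_lt1// ltr1n.
Qed.

Let K := 16 * A * 4 `^ k / (1 - theta).

Let K0 : 0 <= K.
Proof. by rewrite divr_ge0 ?subr_ge0 ?(ltW theta_lt1)// !mulr_ge0 ?powR_ge0. Qed.

Let KE : K * (1 - theta) = 16 * A * 4 `^ k.
Proof. by rewrite divfK// gt_eqF// subr_gt0. Qed.

(* The directions of secants issued from [y] turn by [O(d `^ k)] between the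
   scales [d] and [2 d], and these amounts are summable over dyadic scales. *)
Let dyadic_chain y w z (j : nat) : G y -> G w -> G z ->
  enorm (w - y) * 2^-1 ^+ j / 2 <= enorm (z - y) <= enorm (w - y) ->
  0 < enorm (w - y) ->
  parallel (K * enorm (w - y) `^ k * (1 - theta ^+ j.+1)) (z - y) (w - y).
Proof.
set r := enorm (w - y) => Gy Gw + + r0.
elim: j z => [|j IH] z Gz /andP[zl zr].
  rewrite expr0 mulr1 in zl.
  apply: parallelW (@angle_at y z w (2 * r) Gy Gz Gw _ _ _ _).
  - rewrite expr1 [leRHS]mulrAC KE -!mulrA ler_wpM2l// ler_wpM2l// -powRM ?(ltW r0)//.
    by apply: powk_le; rewrite ?mulr_ge0 ?(ltW r0)// ler_wpM2r ?(ltW r0)// ler_nat.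
  - by rewrite mulr_gt0.
  - by rewrite (le_trans zr) ?andbT; [lra|lra].
  - by rewrite -/r; apply/andP; split; lra.
  - by have := enorm_distD y z w; rewrite (enorm_distC y) -/r; lra.
have [zj|zj] := leP (r * 2^-1 ^+ j / 2) (enorm (z - y)).
  apply: parallelW (IH z Gz _); last by rewrite zj zr.
  rewrite ler_wpM2l ?(mulr_ge0 K0 (powR_ge0 _ _))// lerD2l lerN2. 
  by rewrite ler_wiXn2l// ltW.
set d := enorm (z - y) in zl zr zj *.
have j0 : 0 < r * 2^-1 ^+ j.+1 by rewrite mulr_gt0// exprn_gt0.
have d0 : 0 < d by apply: lt_le_trans zl; rewrite divr_gt0.
have j1 : r * 2^-1 ^+ j <= r.
  by rewrite ler_piMr ?(ltW r0)// exprn_ile1// invf_le1// ler1n.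
(* A point of [G] twice as far from [y] as [z] lies one scale further out, where the induction
   hypothesis applies. *)
have [|z' Gz' dz'] := @G_connected y w (2 * d) Gy Gw.
  by rewrite -/r; lra.
have z'0 : z' - y != 0 by rewrite -enorm_gt0 dz' mulr_gt0.
have h1 : parallel (K * r `^ k * (1 - theta ^+ j.+1)) (z' - y) (w - y).
  apply: IH => //; rewrite dz'; apply/andP; split; last by lra.
  by move: zl; rewrite exprS; lra.
have h2 : parallel (16 * A * (4 * d) `^ k) (z - y) (z' - y).
  apply: angle_at => //.
  - by rewrite mulr_gt0.
  - by rewrite -/d; lra.
  - by rewrite dz'; lra.
  - by have := enorm_distD y z z'; rewrite (enorm_distC y) dz' -/d; lra.
apply: parallelW (parallel_trans z'0 h2 h1).
(* Here d < r 2^-(j + 1). By [KE] the angle added at this scale is at most K r^k (theta^(j + 1) -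
   theta^(j + 2)), so the bounds telescope. *)
have h3 : (4 * d) `^ k <= 4 `^ k * (r `^ k * theta ^+ j.+1).
  have -> : theta ^+ j.+1 = (2^-1 ^+ j.+1) `^ k.
    by rewrite /theta -powR_mulrn ?powR_ge0// powRAC powR_mulrn.
  rewrite -!powRM ?(ltW r0) ?(ltW j0) ?exprn_ge0//.
  apply: powk_le; first by rewrite mulr_ge0// ltW.
  by rewrite ler_wpM2l// exprS; lra.
apply: (@le_trans _ _ (16 * A * 4 `^ k * (r `^ k * theta ^+ j.+1) +
    K * r `^ k * (1 - theta ^+ j.+1))).
  by rewrite lerD2r -[leRHS]mulrA ler_wpM2l// mulr_ge0.
rewrite -KE [theta ^+ j.+2]exprS le_eqVlt; apply/orP; left; apply/eqP.
by ring.
Qed.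

Let chain y w z : G y -> G w -> G z -> enorm (z - y) <= enorm (w - y) ->
  parallel (K * enorm (w - y) `^ k) (z - y) (w - y).
Proof.
move=> Gy Gw Gz zw.
have [->|zy0] := eqVneq (z - y) 0.
  by rewrite /parallel wedge0l enorm0 mul0r mulr0.
have d0 : 0 < enorm (z - y) by rewrite enorm_gt0.
have r0 : 0 < enorm (w - y) by exact: lt_le_trans zw.
have [j _ Hj] := near_infty_natSinv_expn_lt (PosNum (divr_gt0 d0 r0)).
apply: parallelW (dyadic_chain (j := j) Gy Gw Gz _ r0).
  by rewrite ler_piMr ?(mulr_ge0 K0 (powR_ge0 _ _))// gerBl exprn_ge0// ltW.
rewrite zw andbT.
have := Hj j (leqnn j); rewrite /= div1r ltr_pdivlMr// -exprVn => h.
have : 0 < 2^-1 ^+ j * enorm (w - y) by rewrite mulr_gt0// exprn_gt0.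
rewrite (mulrC (enorm _)); lra.
Qed.

(** [b - a] will be a longest secant. As [b] is far from [y], the direction [b - y] mediates:
    [z - y] is compared with it by [chain], or at a single scale when longer, and [b - y] is
    comparable in length with [b - a]. *)
Let far_pair a b y z : G a -> G b -> G y -> G z -> 0 < enorm (b - a) ->
  enorm (z - y) <= enorm (b - a) -> enorm (a - y) <= enorm (b - a) ->
  enorm (b - y) <= enorm (b - a) -> enorm (b - z) <= enorm (b - a) ->
  enorm (b - a) / 2 <= enorm (b - y) ->
  parallel ((K + 32 * A) * enorm (b - a) `^ k) (z - y) (b - a).
Proof.
set D := enorm (b - a) => Ga Gb Gy Gz D0 zy ay by_ bz by2.
have by0 : b - y != 0 by rewrite -enorm_gt0; lra.
have h1 : parallel ((K + 16 * A) * D `^ k) (z - y) (b - y).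
  rewrite mulrDl; have [zyb|zyb] := leP (enorm (z - y)) (enorm (b - y)).
    apply: parallelW (chain Gy Gb Gz zyb).
    have le1 : K * enorm (b - y) `^ k <= K * D `^ k.
      by apply: ler_wpM2l => //; apply: powk_le => //; exact: enorm_ge0.
    have ge1 : 0 <= 16 * A * D `^ k by rewrite !mulr_ge0 ?powR_ge0.
    by rewrite (le_trans le1)// lerDl.
  apply: parallelW (@angle_at y z b D Gy Gz Gb D0 _ _ _).
  - by rewrite lerDr mulr_ge0 ?powR_ge0.
  - by rewrite zy andbT; lra.
  - by rewrite by_ andbT; lra.
  - by rewrite enorm_distC.
have h2 : parallel (16 * A * D `^ k) (b - y) (b - a).
  rewrite /parallel wedgeBl wedgeBr (enorm_distC b y) (enorm_distC b a).
  apply: angle_at => //.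
  - by rewrite enorm_distC by_ andbT; lra.
  - by rewrite enorm_distC -/D; lra.
  - by rewrite enorm_distC.
apply: parallelW (parallel_trans by0 h1 h2).
by rewrite le_eqVlt; apply/orP; left; apply/eqP; ring.
Qed.

Lemma secant_constant_ge0 : 0 <= secant_constant A k.
Proof. by rewrite mulr_ge0// addr_ge0// mulr_ge0. Qed.

Lemma secants_parallel y z y' z' r : G y -> G z -> G y' -> G z' ->
  {in [:: y; z; y'; z'] &, forall u v, enorm (u - v) <= r} ->
  wedge_norm (z - y) (z' - y') <=
    secant_constant A k * r `^ k * (enorm (z - y) * enorm (z' - y')).
Proof.
move=> Gy Gz Gy' Gz' Gr.
pose s := [:: y; z; y'; z']; pose P (i : 'I_4) := nth y s i.
have Ps i : P i \in s by apply: mem_nth.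
have sP u : u \in s -> exists i, u = P i.
  move=> us; have us4 : (index u s < 4)%N by rewrite -[4%N]/(size s) index_mem.
  by exists (Ordinal us4); rewrite /P nth_index.
have GP i : G (P i).
  by have := Ps i; rewrite !inE => /or4P[] /eqP ->.
pose ij0 : 'I_4 * 'I_4 := (ord0, ord0).
(* The two secants need not share a point, so both are compared with a pair [a], [b] realizing the
   diameter of the four points. *)
case: (@arg_maxP _ _ _ ij0 xpredT (fun ij => enorm (P ij.2 - P ij.1)) isT).
move=> [i j] _ /= Hmax.
set a := P i in Hmax; set b := P j in Hmax.
have max_ u v : u \in s -> v \in s -> enorm (u - v) <= enorm (b - a).
  move=> /sP[k1 ->] /sP[k2 ->]; exact: (Hmax (k2, k1)).
have [ys zs y's z's] : [/\ y \in s, z \in s, y' \in s & z' \in s].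
  by rewrite !inE !eqxx !orbT.
have as_ : a \in s by exact: Ps.
have bs : b \in s by exact: Ps.
have [ba0|ba0] := eqVneq (b - a) 0.
  have : enorm (z - y) <= 0 by rewrite -(enorm0 (n := n)) -ba0; exact: max_.
  rewrite le_eqVlt ltNge enorm_ge0 orbF enorm_eq0 => /eqP ->.
  by rewrite wedge0l enorm0 mul0r mulr0.
have D0 : 0 < enorm (b - a) by rewrite enorm_gt0.
have side u v : u \in s -> v \in s -> G u -> G v ->
    parallel ((K + 32 * A) * enorm (b - a) `^ k) (v - u) (b - a).
  move=> us vs Gu Gv.
  (* Every point is at least half the diameter away from [b] or from [a]. *)
  have [bu|bu] := leP (enorm (b - a) / 2) (enorm (b - u)).
    by apply: far_pair; rewrite ?max_//; exact: GP.
  have au : enorm (a - b) / 2 <= enorm (a - u).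
    have := enorm_distD u b a; rewrite (enorm_distC u a) (enorm_distC a b); lra.
  rewrite /parallel wedgeBr (enorm_distC b a).
  apply: far_pair; rewrite 1?(enorm_distC a b) ?max_//; try exact: GP.
  by rewrite (enorm_distC b a).
have h1 := side y z ys zs Gy Gz.
have h2 : parallel ((K + 32 * A) * enorm (b - a) `^ k) (b - a) (z' - y').
  rewrite /parallel wedgeC (mulrC (enorm (b - a))).
  exact: side.
apply: parallelW (parallel_trans ba0 h1 h2).
rewrite /secant_constant -/theta -/K.
have : enorm (b - a) `^ k <= r `^ k by apply: powk_le; rewrite ?enorm_ge0// Gr.
have : 0 <= K + 32 * A by rewrite addr_ge0// mulr_ge0.
nra.
Qed.

End SecantDirections.

(** * Embedded closed curves that are flat at a fixed scale *)

Section PeriodicMaps.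
Context {R : realType} {T : Type}.
Implicit Types (f : R -> T).

Lemma periodic1_int f : periodic1 f -> forall (m : int) t, f (t + m%:~R) = f t.
Proof.
move=> pf m t.
have pn (k : nat) s : f (s + k%:R) = f s.
  by elim: k s => [|k IH] s; rewrite ?addr0// -natr1 addrA pf IH.
case: m => k; first exact: pn.
by rewrite NegzE mulrNz -(pn k.+1 (t - _)) subrK.
Qed.

Lemma periodic1_unit f : periodic1 f -> forall t,
  exists2 m : int, 0 <= t + m%:~R < 1 & f (t + m%:~R) = f t.
Proof.
move=> pf t; exists (- Num.floor t); last exact: periodic1_int.
rewrite mulrNz; have /andP[h1 h2] := floor_itv t.
by rewrite subr_ge0 h1 ltrBlDl (lt_le_trans h2)// intrD.
Qed.

End PeriodicMaps.

Section EmbeddedCurves.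
Context {R : realType} {n : nat}.
Implicit Types (g : R -> 'rV[R]_n) (v : R -> R).

Lemma embedded_int g s t : embedded g -> g s = g t ->
  exists m : int, s = t + m%:~R.
Proof.
move=> [_ pg ig] gst.
have [m mI gm] := periodic1_unit pg s; have [k kI gk] := periodic1_unit pg t.
have smtk : s + m%:~R = t + k%:~R.
  by apply: ig; rewrite ?inE ?in_itv//= gm gk.
by exists (k - m); rewrite intrB; lra.
Qed.

Lemma embedded_inj g s t : embedded g -> `|s - t| < 1 -> g s = g t -> s = t.
Proof.
move=> eg st /(embedded_int eg)[m sE]; move: st.
rewrite sE addrC addKr -intr_norm -[1]/(1%:~R) ltr_int => m1.
have -> : m = 0 by move: m1; case: m {sE} => -[].
by rewrite ?addr0 ?add0r.
Qed.

(** Smallness is measured in space, so strands far apart along the curve are compared too. *)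
Definition flat_at_scale g (d r : R) : Prop := forall s t s' t',
  {in [:: g s; g t; g s'; g t'] &, forall x y, enorm (x - y) <= r} ->
  wedge_norm (g t - g s) (g t' - g s') <=
    d * (enorm (g t - g s) * enorm (g t' - g s')).

Lemma energy_flat (p q E d : R) : 1 < q -> 2 / 3 * q + 1 < p -> 0 < E -> 0 < d ->
  exists2 r : R, 0 < r & forall g v, continuous g -> periodic1 g ->
    speed_minorant g v -> (intM p q g <= E%:E)%E -> flat_at_scale g d r.
Proof.
move=> q1 pq E0 d0.
have p0 : 0 < p by lra.
have [A A0 HA] := @wedge_le_energy R n p q E q1 p0 E0.
set k := _ / _ in HA.
have k0 : 0 < k by rewrite divr_gt0//; lra.
pose B := secant_constant A k.
have B0 : 0 <= B by exact: secant_constant_ge0.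
(* Chosen so that [B] times its k-th power is at most [d]; the [+ 1] allows [B = 0]. *)
exists ((d / (B + 1)) `^ k^-1); first by rewrite powR_gt0// divr_gt0// ltr_wpDl.
move=> g v cg pg gv gE s t s' t' Hr.
have gu u : exists2 u', 0 <= u' <= 1 & g u' = g u.
  have [m /andP[m0 m1] <-] := periodic1_unit pg u.
  by exists (u + m%:~R) => //; rewrite m0 ltW.
apply: le_trans (@secants_parallel _ _ (range g) A k A0 k0 _ _ _ _ _ _ _ _ _ _ _ Hr) _.
- move=> _ _ _ r [u1 _ <-] [u2 _ <-] [u3 _ <-].
  have [v1 v1I <-] := gu u1; have [v2 v2I <-] := gu u2.
  by have [v3 v3I <-] := gu u3; exact: HA gv gE _ _ _ _ _ _ _.
- move=> _ _ e [u1 _ <-] [u2 _ <-] /andP[e0 eu].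
  have cf := enorm_dist_continuous (x := g u1) cg.
  have [u12|/ltW u21] := leP u1 u2.
    have [|c _ fc] := ivt_le (y := e) cf u12; last by exists (g c).
    by rewrite subrr enorm0 e0.
  have [|c _ [fc _]] := last_hit (y := e) cf u21; last by exists (g c).
  by rewrite subrr enorm0 e0.
- by exists s.
- by exists t.
- by exists s'.
- by exists t'.
rewrite ler_wpM2r ?mulr_ge0 ?enorm_ge0// -/B.
rewrite -powRrM mulVf ?gt_eqF// powRr1 ?divr_ge0 ?(ltW d0) ?addr_ge0//.
rewrite mulrA ler_pdivrMr ?ltr_wpDl//; nra.
Qed.

Lemma flat_in_ball g (d r rho : R) (x : 'rV[R]_n) s t s' t' :
  flat_at_scale g d r -> 2 * rho <= r ->
  enorm (g s - x) <= rho -> enorm (g t - x) <= rho ->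
  enorm (g s' - x) <= rho -> enorm (g t' - x) <= rho ->
  wedge_norm (g t - g s) (g t' - g s') <=
    d * (enorm (g t - g s) * enorm (g t' - g s')).
Proof.
move=> Hf rr hs ht hs' ht'; apply: Hf => y z.
have near_ w : w \in [:: g s; g t; g s'; g t'] -> enorm (w - x) <= rho.
  by rewrite !inE => /or4P[] /eqP ->.
move=> /near_ hy /near_ hz.
have := enorm_distD x y z; rewrite (enorm_distC x z); lra.
Qed.

(** A secant that is nearly parallel to a nonzero vector and orthogonal to it must vanish. *)
Lemma flat_dotp_inj g (d r rho : R) (x : 'rV[R]_n) s t s' t' :
  flat_at_scale g d r -> 0 <= d < 1 -> 2 * rho <= r ->
  enorm (g s - x) <= rho -> enorm (g t - x) <= rho ->
  enorm (g s' - x) <= rho -> enorm (g t' - x) <= rho ->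
  0 < enorm (g t' - g s') ->
  dotp (g s) (g t' - g s') = dotp (g t) (g t' - g s') -> g s = g t.
Proof.
move=> Hf /andP[d0 d1] rr hs ht hs' ht' e0 st.
have := flat_in_ball Hf rr hs ht hs' ht'.
move=> /(dotp_parallel_ge (d := d)); rewrite d0 (ltW d1) => /(_ isT).
rewrite dotpBl st subrr normr0 pmulr_rle0 ?subr_gt0// => h.
have : enorm (g t - g s) <= 0 by rewrite -(pmulr_lle0 _ e0).
rewrite le_eqVlt ltNge enorm_ge0 orbF enorm_eq0 subr_eq0 => /eqP.
by [].
Qed.

(* If both arcs left the ball, the strand through [g u] would cross it almost
   straight, so its projection onto a line, injective on the curve inside the
   ball, would take the value taken at the point [g v] off the strand. *)
Lemma near_points_short_arc g (d r rho u w : R) : embedded g ->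
  flat_at_scale g d r -> 0 <= d <= 1 / 2 -> 0 < rho -> 2 * rho <= r ->
  u <= w <= u + 1 -> enorm (g w - g u) < rho / 2 ->
  (forall t, u <= t <= w -> enorm (g t - g u) < rho) \/
  (forall t, w <= t <= u + 1 -> enorm (g t - g u) < rho).
Proof.
move=> eg Hf /andP[d0 d1] rho0 rr /andP[uw wu] gwu.
have [cg pg _] := eg.
apply: or_asboolP; rewrite -[_ || _]negbK negb_or; apply/negP => /andP[].
move=> /asboolP/existsNP[t1 /not_implyP[/andP[ut1 t1w] /negP]].
rewrite -leNgt => gt1.
move=> /asboolP/existsNP[t2 /not_implyP[/andP[wt2 t2u] /negP]].
rewrite -leNgt => gt2.
pose x := g u; have cf := enorm_dist_continuous (x := x) cg.
(* [b] is the first exit after [u], and [a' = a - 1] the last entry before it: [[a', b]]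
   parametrizes one strand in the closed ball with both ends on the sphere. *)
have [|b /andP[ub bt1] [gb Hb]] := first_hit (y := rho) cf ut1.
  by rewrite subrr enorm0 (ltW rho0).
have [|a /andP[t2a au] [ga Ha]] := last_hit (y := rho) cf t2u.
  by rewrite pg subrr enorm0 (ltW rho0).
have aw : a != w by apply: contraTneq gwu => <-; rewrite -leNgt ga; lra.
have bw : b != w by apply: contraTneq gwu => <-; rewrite -leNgt gb; lra.
have {}aw : w < a by rewrite lt_neqAle eq_sym aw (le_trans wt2).
have {}bw : b < w by rewrite lt_neqAle bw (le_trans bt1).
pose a' := a - 1.
have a'u : a' <= u by rewrite /a'; lra.
have in_ball t : a' <= t <= b -> enorm (g t - x) <= rho.
  move=> /andP[a't tb]; have [tu|/ltW ut] := leP t u.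
    rewrite -pg; apply: Ha; rewrite /a' in a't; apply/andP; lra.
  by apply: Hb; rewrite ut.
have ga' : enorm (g a' - x) = rho by rewrite -pg /a' subrK.
pose e := g b - x; have e0 : 0 < enorm e by rewrite gb.
pose f t := dotp (g t) e.
have cdot : continuous f by exact: dotp_continuous.
have ballx : enorm (g u - x) <= rho by rewrite subrr enorm0 ltW.
have ballb : enorm (g b - x) <= rho by rewrite gb.
have finj s t : a' <= s <= b -> enorm (g t - x) <= rho -> f s = f t -> g s = g t.
  move=> sI tI; apply: (flat_dotp_inj Hf _ rr _ tI ballx ballb) => //.
    by rewrite d0; lra.
  exact: in_ball.
have fb : f b = f u + rho ^+ 2.
  by rewrite -gb sqr_enorm -/e /f -dotpDl addrC subrK.
have fa' : (1 - d) * rho ^+ 2 <= `|f a' - f u|.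
  have := flat_in_ball Hf rr ballx (in_ball a' _) ballx ballb.
  rewrite lexx (le_trans a'u ub) => /(_ isT).
  move=> /(dotp_parallel_ge (d := d)); rewrite d0 -/x -/e => /(_ _).
  rewrite dotpBl -/(f a') -/(f u) ga' [enorm e]gb expr2; apply.
  lra.
have rho2 : 0 < rho ^+ 2 by rewrite exprn_gt0.
(* Otherwise both ends project to the same side of [f u], and the level [y] is taken before and
   after [u], against injectivity on the strand. *)
have fa'u : f a' <= f u - (1 - d) * rho ^+ 2.
  rewrite leNgt; apply/negP => fa'2.
  have {}fa'2 : f u + (1 - d) * rho ^+ 2 <= f a'.
    by move: fa' fa'2; case: (ger0P (f a' - f u)) => h; nra.
  pose y := f u + rho ^+ 2 / 2.
  have dr : 1 / 2 * rho ^+ 2 <= (1 - d) * rho ^+ 2 by rewrite ler_wpM2r ?(ltW rho2)//; lra.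
  have [|s1 /andP[us1 s1b] fs1] := ivt_le (y := y) cdot ub.
    by rewrite fb /y; lra.
  have [|s2 /andP[a's2 s2u] [fs2 _]] := last_hit (y := y) cdot a'u.
    by rewrite /y; lra.
  have s12 : s1 = s2.
    apply: (embedded_inj eg); first by rewrite ltr_norml /a' in a's2 *; lra.
    apply: finj; last by rewrite fs1 fs2.
      by rewrite s1b (le_trans a'u).
    by apply: in_ball; rewrite a's2 (le_trans s2u).
  have su : s1 = u by apply/eqP; rewrite eq_le us1 s12 s2u.
  by move: fs1; rewrite su /y; lra.
have fw : `|f w - f u| <= rho ^+ 2 / 2.
  rewrite -dotpBl (le_trans (dotp_le_enorm _ _))// [enorm e]gb.
  by move: gwu; rewrite -/x expr2; nra.
have dr : 1 / 2 * rho ^+ 2 <= (1 - d) * rho ^+ 2 by rewrite ler_wpM2r ?(ltW rho2)//; lra.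
(* [f w] is within half of [rho ^+ 2] of [f u], so the strand attains it; injectivity then puts [w]
   on the strand although [b < w]. *)
have [|s /andP[a's sb] fs] := ivt_le (y := f w) cdot (le_trans a'u ub).
  by move: fw; rewrite ler_norml fb; lra.
have sw : s = w.
  apply: (embedded_inj eg); first by rewrite ltr_norml /a' in a's *; lra.
  by apply: finj => //; [rewrite a's sb|rewrite -/x; lra].
by move: bw; rewrite ltNge -sw sb.
Qed.

(** [e] is the direction of the whole chord, nonzero as [w < u + 1]. The projection to it is
    injective on the arc, hence monotone, so all secants point forward and [near_direction]
    applies. *)
Lemma arc_direction g (d r u w : R) : embedded g -> flat_at_scale g d r ->
  0 <= d < 1 -> u < w < u + 1 ->
  (forall t, u <= t <= w -> enorm (g t - g u) <= r / 2) ->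
  exists2 e : 'rV[R]_n, enorm e = 1 & forall s t, u <= s -> s <= t -> t <= w ->
    enorm (g t - g s - enorm (g t - g s) *: e) <= 2 * d * enorm (g t - g s).
Proof.
move=> eg Hf dI /andP[uw wu1] Hb.
have [cg pg _] := eg; have /andP[d0 d1] := dI.
have rr : 2 * (r / 2) <= r by lra.
have bu : enorm (g u - g u) <= r / 2 by apply: Hb; rewrite lexx ltW.
have bw : enorm (g w - g u) <= r / 2 by apply: Hb; rewrite lexx ltW.
pose e0 := g w - g u.
have e0_neq0 : e0 != 0.
  rewrite subr_eq0; apply/eqP => gwu.
  have : w = u by apply: (embedded_inj eg) => //; rewrite ltr_norml; lra.
  by move=> wu; move: uw; rewrite wu ltxx.
have e0_gt0 : 0 < enorm e0 by rewrite enorm_gt0.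
pose f t := dotp (g t) e0.
have fuw : f u <= f w by rewrite -subr_ge0 -dotpBl dotpp_ge0.
have finj : {in `[u, w] &, injective f}.
  move=> s t; rewrite !in_itv/= => sI tI fst.
  apply: (embedded_inj eg); last first.
    by apply: (flat_dotp_inj Hf dI rr (Hb s sI) (Hb t tI) bu bw).
  by rewrite ltr_norml; lra.
have fmono := segment_continuous_inj_le fuw
  (continuous_subspaceT (dotp_continuous (e := e0) cg)) finj.
exists ((enorm e0)^-1 *: e0); first exact: enorm_scale_inv.
move=> s t us st tw.
have sI : u <= s <= w by rewrite us (le_trans st).
have tI : u <= t <= w by rewrite tw (le_trans us).
apply: near_direction => //.
- exact: enorm_scale_inv.
- rewrite dotpC dotpZl mulr_ge0 ?invr_ge0 ?enorm_ge0// dotpC dotpBl subr_ge0.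
  by rewrite [_ <= _]fmono.
- rewrite wedgeZr enormZ ger0_norm ?invr_ge0 ?enorm_ge0//.
  rewrite [leRHS](_ : _ = (enorm e0)^-1 * (d * (enorm (g t - g s) * enorm e0))).
    rewrite ler_wpM2l ?invr_ge0 ?enorm_ge0//.
    exact: (flat_in_ball Hf rr (Hb s sI) (Hb t tI) bu bw).
  by ring.
Qed.

End EmbeddedCurves.

(** * A periodic trigonometric kernel with an explicit primitive *)

Section PeriodicKernel.
Context {R : realType}.
Implicit Types (f g : R -> R) (s t x y : R) (k : nat).

Definition hav t : R := (1 + cos (2 * pi * t)) / 2.

(** The mean of [hav ^+ k] over a period, where [hav t] is cos^2 (pi t). Thus [kern k] has mean 1
    and concentrates at the integers. *)
Definition wallis k : R := \prod_(i < k) ((2 * i%:R + 1) / (2 * i%:R + 2)).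

Definition kern k t : R := hav t ^+ k / wallis k.

(* An explicit primitive of [kern k]: since
   [(sin (2 pi t) * hav t ^+ k)' = 2 pi ((2 k + 2) hav t - (2 k + 1)) hav t ^+ k],
   the increment below has derivative [kern k.+1 - kern k]. *)
Fixpoint kern_prim k t : R :=
  if k is k'.+1 then
    kern_prim k' t +
      (2 * pi * (2 * k'%:R + 1) * wallis k')^-1 *
      (sin (2 * pi * t) * hav t ^+ k')
  else t.

Lemma wallisS k : wallis k.+1 = wallis k * ((2 * k%:R + 1) / (2 * k%:R + 2)).
Proof. by rewrite /wallis big_ord_recr. Qed.

Lemma wallis_gt0 k : 0 < wallis k.
Proof.
apply: prodr_gt0 => i _; have : 0 <= i%:R :> R by [].
by move=> h; rewrite divr_gt0//; lra.
Qed.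

Lemma hav_ge0 t : 0 <= hav t.
Proof. by rewrite divr_ge0//; have := cos_geN1 (2 * pi * t); lra. Qed.

Lemma hav_le1 t : hav t <= 1.
Proof. by rewrite /hav; have := cos_le1 (2 * pi * t); lra. Qed.

Lemma havD1 t : hav (t + 1) = hav t.
Proof.
by rewrite /hav mulrDr mulr1 [2 * pi]mulr_natl cosD2pi.
Qed.

Lemma sin2piD1 t : sin (2 * pi * (t + 1)) = sin (2 * pi * t).
Proof. by rewrite mulrDr mulr1 [2 * pi]mulr_natl sinD2pi. Qed.

Lemma kern_ge0 k t : 0 <= kern k t.
Proof. by rewrite divr_ge0 ?exprn_ge0 ?hav_ge0// ltW// wallis_gt0. Qed.

Lemma kern_primD1 k t : kern_prim k (t + 1) = kern_prim k t + 1.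
Proof.
elim: k => [//|k IH] /=.
by rewrite IH havD1 sin2piD1 addrAC.
Qed.

Lemma is_derive_addf f g t (a b : R) : is_derive t 1 f a -> is_derive t 1 g b ->
  is_derive t 1 (fun s => f s + g s) (a + b).
Proof. by move=> fa gb; exact: (is_deriveD fa gb). Qed.

Lemma is_derive_mulf f g t (a b : R) : is_derive t 1 f a -> is_derive t 1 g b ->
  is_derive t 1 (fun s => f s * g s) (f t * b + g t * a).
Proof. by move=> fa gb; exact: (is_deriveM fa gb). Qed.

Lemma is_derive_compf f g t (a b : R) : is_derive (g t) 1 f a -> is_derive t 1 g b ->
  is_derive t 1 (fun s => f (g s)) (a * b).
Proof. by move=> fa gb; exact: (is_derive1_comp fa gb). Qed.

Lemma is_derive_cstf (c t : R) : is_derive t 1 (fun=> c) 0.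
Proof. exact: is_derive_cst. Qed.

Lemma is_derive_idf t : is_derive t 1 (fun s => s) 1.
Proof. exact: is_derive_id. Qed.

Lemma is_derive_scalef (c : R) f t (a : R) : is_derive t 1 f a ->
  is_derive t 1 (fun s => c * f s) (c * a).
Proof.
move=> fa; apply: is_derive_eq (is_derive_mulf (is_derive_cstf c t) fa) _.
by rewrite mulr0 addr0.
Qed.

Lemma is_derive_expf f t (a : R) k : is_derive t 1 f a ->
  is_derive t 1 (fun s => f s ^+ k) (k%:R * f t ^+ k.-1 * a).
Proof.
move=> fa; elim: k => [|k IH].
  by rewrite !mul0r; apply: is_derive_eq (is_derive_cstf 1 t) _.
have -> : (fun s => f s ^+ k.+1) = (fun s => f s * f s ^+ k).
  by apply/funext => s; rewrite exprS.
apply: is_derive_eq (is_derive_mulf fa IH) _.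
by case: k {IH} => [|k]; rewrite /= ?exprS -?natr1; ring.
Qed.

Lemma is_derive_sin2pi t :
  is_derive t 1 (fun s => sin (2 * pi * s)) (2 * pi * cos (2 * pi * t)).
Proof.
apply: is_derive_eq
  (is_derive_compf (is_derive_sin (2 * pi * t)) (is_derive_scalef (2 * pi) (is_derive_idf t))) _.
by rewrite mulr1 mulrC.
Qed.

Lemma is_derive_cos2pi t :
  is_derive t 1 (fun s => cos (2 * pi * s)) (- (2 * pi * sin (2 * pi * t))).
Proof.
apply: is_derive_eq
  (is_derive_compf (is_derive_cos (2 * pi * t)) (is_derive_scalef (2 * pi) (is_derive_idf t))) _.
by rewrite mulr1 mulNr mulrC.
Qed.

Lemma is_derive_hav t : is_derive t 1 hav (- (pi * sin (2 * pi * t))).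
Proof.
have -> : hav = fun s => 2^-1 * (1 + cos (2 * pi * s)).
  by apply/funext => s; rewrite /hav mulrC.
apply: is_derive_eq (is_derive_scalef 2^-1 (is_derive_addf (is_derive_cstf 1 t) (is_derive_cos2pi t))) _.
by field.
Qed.

Lemma is_derive_kern_prim k t : is_derive t 1 (kern_prim k) (kern k t).
Proof.
elim: k => [|k IH].
  apply: is_derive_eq (is_derive_idf t) _.
  by rewrite /kern /wallis big_ord0 expr0 divr1.
have dk := is_derive_mulf (is_derive_sin2pi t) (is_derive_expf k (is_derive_hav t)).
apply: is_derive_eq (is_derive_addf IH (is_derive_scalef _ dk)) _.
have w0 : wallis k != 0 by rewrite gt_eqF// wallis_gt0.
have k0 : 0 <= k%:R :> R by [].
have k1 : 2 * k%:R + 1 != 0 :> R by rewrite gt_eqF//; lra.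
have k2 : 2 * k%:R + 2 != 0 :> R by rewrite gt_eqF//; lra.
have p0 : pi != 0 :> R by rewrite gt_eqF// pi_gt0.
have cE : cos (2 * pi * t) = 2 * hav t - 1 by rewrite /hav; field.
have sE : sin (2 * pi * t) ^+ 2 = 4 * hav t * (1 - hav t).
  by rewrite sin2cos2 cE; ring.
have e1 : sin (2 * pi * t) * (k%:R * hav t ^+ k.-1 *
    - (pi * sin (2 * pi * t))) = - (4 * pi * k%:R * hav t ^+ k * (1 - hav t)).
  transitivity (- (pi * k%:R * hav t ^+ k.-1 * sin (2 * pi * t) ^+ 2)).
    by ring.
  rewrite sE; case: k {IH dk w0 k0 k1 k2} => [|k]; first by rewrite !(mulr0, mul0r).
  by rewrite [in RHS]exprS /=; ring.
rewrite e1 cE /kern wallisS exprS.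
move: (hav t) p0 => c; move: (@pi R) => P p0; field.
by rewrite w0 k1 k2 p0.
Qed.

Lemma kern_prim_nondecreasing k x y : x <= y -> kern_prim k x <= kern_prim k y.
Proof.
move=> xy; have dP s : derivable (kern_prim k) s 1.
  by have [] := is_derive_kern_prim k s.
apply: (@ger0_derive1_ndecr _ (kern_prim k) x y) => // [s _|].
  by rewrite derive1E (derive_val (is_derive := is_derive_kern_prim k s)) kern_ge0.
apply: continuous_subspaceT => s.
exact/differentiable_continuous/derivable1_diffP.
Qed.

End PeriodicKernel.

(** * Primitives of continuous functions on the line *)

Section Primitives.
Context {R : realType}.
Implicit Types (f g F : R -> R) (a b t : R).

Let mu := @lebesgue_measure R.

Lemma is_derive_continuous F f : (forall t, is_derive t 1 F (f t)) ->
  continuous F.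
Proof.
move=> dF t; have [h _] := dF t.
exact/differentiable_continuous/derivable1_diffP.
Qed.

Lemma is_derive_derive1 F f : (forall t, is_derive t 1 F (f t)) ->
  derive1 F = f.
Proof. by move=> dF; apply/funext => t; rewrite derive1E; have [] := dF t. Qed.

Lemma is_derive_nondecreasing F f a b :
  (forall t, is_derive t 1 F (f t)) -> (forall t, a < t < b -> 0 <= f t) ->
  a <= b -> F a <= F b.
Proof.
move=> dF f0 ab.
apply: (@ger0_derive1_ndecr _ F a b) => // [t|].
- by rewrite in_itv/= => tI; rewrite (is_derive_derive1 dF) f0.
- exact/continuous_subspaceT/(is_derive_continuous dF).
Qed.

Lemma continuous_integrable_itv f a b : continuous f ->
  mu.-integrable `[a, b] (EFin \o f).
Proof.
move=> cf; apply: continuous_compact_integrable; first exact: segment_compact.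
exact: continuous_subspaceT.
Qed.

(** [J M x] is the signed integral from 0 to [x], written with a far left end. It does not depend on
    [M] once [M] is large, so each [x] may use its own [M], and a common one serves near [t]. *)
Lemma primitive_exists f : continuous f ->
  exists F, forall t, is_derive t 1 F (f t).
Proof.
move=> cf.
have If a b := continuous_integrable_itv a b cf.
pose J (M x : R) := \int[mu]_(s in `[- M, x]) f s - \int[mu]_(s in `[- M, 0]) f s.
have split_itv M N x : 0 <= N -> N <= M -> - N <= x ->
    \int[mu]_(s in `[- M, x]) f s =
    \int[mu]_(s in `[- M, - N]) f s + \int[mu]_(s in `[- N, x]) f s.
  move=> N0 NM Nx; rewrite -[X in _ + X]Rintegral_itv_obnd_cbnd.
    by rewrite -(@Rintegral_itvB _ f (BLeft (- M)) (BRight x) (- N))//;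
      [rewrite addrC subrK|rewrite bnd_simp lerN2].
  apply: integrableS (If (- N) x) => //.
  by apply: subset_itvr; rewrite bnd_simp.
have JE M N x : 0 <= N -> N <= M -> - N <= x -> J M x = J N x.
  move=> N0 NM Nx; rewrite /J (split_itv M N x)// (split_itv M N 0) ?oppr_le0//.
  by ring.
exists (fun x => J (`|x| + 1) x) => t.
have t2 : - (`|t| + 2) < t by have := ler_norm (- t); rewrite normrN; lra.
have tt1 : t < t + 1 by rewrite ltrDl.
have [dF FE] := @continuous_FTC1_closed R f (- (`|t| + 2)) t (t + 1) tt1 (If _ _) t2 (cf t).
have nearJ : {near t, (fun x => \int[mu]_(s in `[- (`|t| + 2), x]) f s -
    \int[mu]_(s in `[- (`|t| + 2), 0]) f s) =1 (fun x => J (`|x| + 1) x)}.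
  near=> x.
  have xt : `|x - t| < 1.
    by rewrite distrC; near: x; exact: nbhsx_ballx.
  have xn : `|x| <= `|t| + 1.
    by rewrite -{1}(subrK t x) (le_trans (ler_normD _ _))// addrC lerD2l ltW.
  by rewrite -[LHS]/(J _ x) (@JE _ (`|x| + 1) x)//;
    [lra|rewrite lerNl; have := ler_norm (- x); rewrite normrN; lra].
have dF' := DeriveDef dF (etrans (esym (derive1E _ _)) FE).
have := is_derive_addf dF'
  (is_derive_cstf (- \int[mu]_(s in `[- (`|t| + 2), 0]) f s) t).
by rewrite addr0; exact: near_eq_is_derive nearJ.
Unshelve. all: by end_near. Qed.

Lemma integral_primitive F f a b : a <= b -> continuous f ->
  (forall t, is_derive t 1 F (f t)) ->
  (\int[mu]_(t in `[a, b]) (f t)%:E = (F b - F a)%:E)%E.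
Proof.
rewrite le_eqVlt => /predU1P[-> _ _|ab cf dF].
  by rewrite set_itv1 integral_set1 subrr.
have cF := is_derive_continuous dF.
rewrite (@continuous_FTC2 _ _ F _ _ ab (continuous_subspaceT cf)) ?EFinB//.
- split.
  + by move=> t _; have [] := dF t.
  + exact/cvg_at_right_filter/cF.
  + exact/cvg_at_left_filter/cF.
- by move=> t _; rewrite (is_derive_derive1 dF).
Qed.

Lemma Rintegral_primitive F f a b : a <= b -> continuous f ->
  (forall t, is_derive t 1 F (f t)) -> \int[mu]_(t in `[a, b]) f t = F b - F a.
Proof.
by move=> ab cf dF; rewrite /Rintegral (integral_primitive ab cf dF).
Qed.

End Primitives.

(** * Concentration of the kernels, and the test functions built from them *)

Section ApproximateIdentity.
Context {R : realType}.
Implicit Types (f h F : R -> R) (s t x y a b : R) (k : nat).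

Let mu := @lebesgue_measure R.

Lemma is_derive_shift F f a : (forall t, is_derive t 1 F (f t)) ->
  forall t, is_derive t 1 (fun s => F (s - a)) (f (t - a)).
Proof.
move=> dF t.
have d1 := is_derive_addf (is_derive_idf t) (is_derive_cstf (- a) t).
apply: is_derive_eq (@is_derive_compf R F (fun s => s - a) t _ _ (dF (t - a)) d1) _.
by rewrite addr0 mulr1.
Qed.

(** A class closed under differentiation that contains the test functions below; smoothness of every
    order follows without computing higher derivatives. *)
Inductive elementary : (R -> R) -> Prop :=
| elementary_cst c : elementary (fun=> c)
| elementary_shift a : elementary (fun t => t - a)
| elementary_sin a : elementary (fun t => sin (2 * pi * (t - a)))
| elementary_cos a : elementary (fun t => cos (2 * pi * (t - a)))
| elementary_add f h : elementary f -> elementary h ->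
    elementary (fun t => f t + h t)
| elementary_mul f h : elementary f -> elementary h ->
    elementary (fun t => f t * h t).

Lemma elementary_is_derive f : elementary f ->
  exists2 f', elementary f' & forall t, is_derive t 1 f (f' t).
Proof.
elim=> [c|a|a|a|{}f h ef [f' ef' df] eh [h' eh' dh]|{}f h ef [f' ef' df] eh [h' eh' dh]].
- by exists (fun=> 0) => [|t]; [exact: elementary_cst|exact: is_derive_cstf].
- exists (fun=> 1) => [|t]; first exact: elementary_cst.
  exact: (@is_derive_shift id (fun=> 1) a (@is_derive_idf R)).
- exists (fun t => 2 * pi * cos (2 * pi * (t - a))) => [|t].
    by apply: elementary_mul; [exact: elementary_cst|exact: elementary_cos].
  exact: (is_derive_shift _ (@is_derive_sin2pi R)).
- exists (fun t => - (2 * pi) * sin (2 * pi * (t - a))) => [|t].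
    by apply: elementary_mul; [exact: elementary_cst|exact: elementary_sin].
  by rewrite mulNr; exact: (is_derive_shift _ (@is_derive_cos2pi R)).
- exists (fun t => f' t + h' t) => [|t]; first exact: elementary_add.
  exact: is_derive_addf.
- exists (fun t => f t * h' t + h t * f' t) => [|t]; last exact: is_derive_mulf.
  by apply: elementary_add; exact: elementary_mul.
Qed.

Lemma elementary_smooth f k t : elementary f -> derivable (derive1n k f) t 1.
Proof.
move=> ef; suff : elementary (derive1n k f).
  by move=> /elementary_is_derive[f' _ df]; have [] := df t.
elim: k => [//|k /elementary_is_derive[f' ef' df]].
by rewrite derive1nS (is_derive_derive1 df).
Qed.

Lemma elementary_kern_prim k a : elementary (fun t => kern_prim k (t - a)).
Proof.
have exp m f : elementary f -> elementary (fun t => f t ^+ m).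
  move=> ef; elim: m => [|m IH].
    have -> : (fun t => f t ^+ 0) = fun=> 1 by apply/funext => t; rewrite expr0.
    exact: elementary_cst.
  have -> : (fun t => f t ^+ m.+1) = fun t => f t * f t ^+ m.
    by apply/funext => t; rewrite exprS.
  exact: elementary_mul.
elim: k => [|k IH] /=; first exact: elementary_shift.
apply: elementary_add => //; apply: elementary_mul; first exact: elementary_cst.
apply: elementary_mul; first exact: elementary_sin.
apply: exp; apply: elementary_mul; last exact: elementary_cst.
by apply: elementary_add; [exact: elementary_cst|exact: elementary_cos].
Qed.

Lemma hav_lt1 t : 0 < t < 1 -> hav t < 1.
Proof.
move=> /andP[t0 t1].
have -> : hav t = 1 - sin (pi * t) ^+ 2.
  by rewrite /hav -mulrA mulr_natl cos_mulr2n cos2sin2; field.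
have : 0 < sin (pi * t).
  apply: sin_gt0_pi; rewrite mulr_gt0 ?pi_gt0//=.
  by rewrite gtr_pMr// pi_gt0.
by move=> s0; rewrite gtrBl exprn_gt0.
Qed.

Lemma hav_continuous : continuous (@hav R).
Proof. exact: is_derive_continuous (@is_derive_hav R). Qed.

Lemma kern_continuous k : continuous (@kern R k).
Proof.
have /elementary_is_derive[f' ef' df] := elementary_kern_prim k 0.
have kE : @kern R k = f'.
  rewrite -(is_derive_derive1 df) -(is_derive_derive1 (is_derive_kern_prim k)).
  by congr derive1; apply/funext => t; rewrite subr0.
have [f'' _ df'] := elementary_is_derive ef'.
rewrite kE; exact: is_derive_continuous df'.
Qed.

Lemma hav_away x y : 0 < x -> x <= y -> y < 1 ->
  exists2 m : R, 0 < m & forall t, x <= t <= y -> m <= 1 - hav t.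
Proof.
move=> x0 xy y1.
have [||c cI Hc] := @EVT_max _ (@hav R) x y => //.
  exact/continuous_subspaceT/hav_continuous.
move: cI; rewrite in_itv/= => /andP[xc cy].
exists (1 - hav c) => [|t tI].
  by rewrite subr_gt0 hav_lt1// (lt_le_trans x0 xc) (le_lt_trans cy).
by rewrite lerD2l lerN2 Hc.
Qed.

(** As [hav * kern k] is (2 k + 1) / (2 k + 2) times [kern k.+1], this is a primitive of
    [kern k * (1 - hav)]. Its increase over a period measures how far [kern k] is from a point
    mass. *)
Let defect k t : R :=
  kern_prim k t - (2 * k%:R + 1) / (2 * k%:R + 2) * kern_prim k.+1 t.

Let is_derive_defect k t : is_derive t 1 (defect k) (kern k t * (1 - hav t)).
Proof.
have := is_derive_addf (is_derive_kern_prim k t)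
  (is_derive_scalef (- ((2 * k%:R + 1) / (2 * k%:R + 2))) (is_derive_kern_prim k.+1 t)).
move=> h; have -> : defect k = fun s => kern_prim k s +
    - ((2 * k%:R + 1) / (2 * k%:R + 2)) * kern_prim k.+1 s.
  by apply/funext => s; rewrite /defect mulNr.
apply: is_derive_eq h _.
have w0 : wallis k != 0 :> R by rewrite gt_eqF// wallis_gt0.
have k0 : 0 <= k%:R :> R by [].
have k1 : 2 * k%:R + 1 != 0 :> R by rewrite gt_eqF//; lra.
have k2 : 2 * k%:R + 2 != 0 :> R by rewrite gt_eqF//; lra.
rewrite /kern wallisS exprS; move: (hav t) => c; field.
by rewrite w0 k1 k2.
Qed.

Let defectD1 k t : defect k (t + 1) = defect k t + (2 * k%:R + 2)^-1.
Proof.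
rewrite /defect !kern_primD1.
have k0 : 0 <= k%:R :> R by [].
have k2 : 2 * k%:R + 2 != 0 :> R by rewrite gt_eqF//; lra.
by field.
Qed.

Let defect_le k x y : x <= y -> defect k x <= defect k y.
Proof.
move=> xy; apply: (is_derive_nondecreasing (is_derive_defect k)) => // t _.
by rewrite mulr_ge0 ?kern_ge0// subr_ge0 hav_le1.
Qed.

(** Chebyshev's argument: on [[x, y]] the density [kern k] is at most 1 / m times
    [kern k * (1 - hav)], whose integral over a full period is 1 / (2 k + 2). *)
Lemma kern_prim_tail k x y (m : R) : 0 < m -> 0 < x -> x <= y -> y < 1 ->
  (forall t, x <= t <= y -> m <= 1 - hav t) ->
  `|kern_prim k y - kern_prim k x| <= m^-1 / (2 * k%:R + 2).
Proof.
move=> m0 x0 xy y1 Hm.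
rewrite ger0_norm ?subr_ge0 ?kern_prim_nondecreasing// -(ler_pM2l m0) !mulrA.
rewrite divff ?gt_eqF// mul1r.
have dh t : is_derive t 1 (fun s => defect k s + - m * kern_prim k s)
    (kern k t * (1 - hav t) + - m * kern k t).
  exact: is_derive_addf (is_derive_defect k t) (is_derive_scalef _ (is_derive_kern_prim k t)).
have := is_derive_nondecreasing dh _ xy => /(_ _)/wrap[t /andP[/ltW xt /ltW ty]|h].
  have -> : kern k t * (1 - hav t) + - m * kern k t =
    kern k t * (1 - hav t - m) by ring.
  by rewrite mulr_ge0 ?kern_ge0// subr_ge0 Hm// xt.
have := defect_le k (ltW x0); have := defect_le k (ltW y1).
have := defectD1 k 0; rewrite add0r; lra.
Qed.

Lemma integral_kern k a : \int[mu]_(t in `[0, 1]) kern k (t - a) = 1.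
Proof.
have cK : continuous (fun t => kern k (t - a)).
  move=> t; apply: (@continuous_comp _ _ _ (fun t => t - a) (kern k)).
    by apply: cvgB; [exact: cvg_id|exact: cvg_cst].
  exact: kern_continuous.
have -> := Rintegral_primitive ler01 cK (is_derive_shift a (is_derive_kern_prim k)).
have -> : 1 - a = (0 - a) + 1 :> R by ring.
by rewrite kern_primD1 addrC addKr.
Qed.

Lemma integral_kern_hav k a :
  \int[mu]_(t in `[0, 1]) (kern k (t - a) * (1 - hav (t - a))) =
  (2 * k%:R + 2)^-1.
Proof.
have cK : continuous (fun t => kern k (t - a) * (1 - hav (t - a))).
  move=> t; apply: (@continuous_comp _ _ _ (fun t => t - a)
    (fun t => kern k t * (1 - hav t))).
    by apply: cvgB; [exact: cvg_id|exact: cvg_cst].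
  apply: cvgM; first exact: kern_continuous.
  by apply: cvgB; [exact: cvg_cst|exact: hav_continuous].
have -> := Rintegral_primitive ler01 cK (is_derive_shift a (is_derive_defect k)).
have -> : 1 - a = (0 - a) + 1 :> R by ring.
by rewrite defectD1 addrC addKr.
Qed.

Lemma cvg_harmonic2 (c : R) : (c / (2 * k%:R + 2)) @[k --> \oo] --> (0 : R).
Proof.
rewrite -(mulr0 (c / 2)).
have -> : (fun k => c / (2 * k%:R + 2)) = (fun k => c / 2 * harmonic k).
  apply/funext => k; rewrite /harmonic /= -natr1.
  have k0 : 0 <= k%:R :> R by [].
  have k2 : 2 * k%:R + 2 != 0 :> R by rewrite gt_eqF//; lra.
  have k1 : k%:R + 1 != 0 :> R by rewrite gt_eqF//; lra.
  by field; rewrite addrC k1 k2.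
by apply: cvgM; [exact: cvg_cst|exact: cvg_harmonic].
Qed.

(** Both primitives gain 1 over a period, so the difference is periodic: a smooth approximation of
    the indicator of [[a, b]], with derivative close to a difference of two point masses. *)
Definition bump a b k t : R := kern_prim k (t - a) - kern_prim k (t - b).

Lemma bump_test a b k : test_function (bump a b k).
Proof.
split=> [t|m t].
  by rewrite /bump (addrAC t 1 (- a)) (addrAC t 1 (- b)) !kern_primD1; ring.
apply: elementary_smooth.
have -> : bump a b k = fun t => kern_prim k (t - a) + -1 * kern_prim k (t - b).
  by apply/funext => s; rewrite /bump mulN1r.
apply: elementary_add; first exact: elementary_kern_prim.
apply: elementary_mul; first exact: elementary_cst.
exact: elementary_kern_prim.
Qed.

Lemma is_derive_bump a b k t :
  is_derive t 1 (bump a b k) (kern k (t - a) - kern k (t - b)).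
Proof.
have := is_derive_addf (is_derive_shift a (is_derive_kern_prim k) t)
  (is_derive_scalef (-1) (is_derive_shift b (is_derive_kern_prim k) t)).
have -> : bump a b k = fun t => kern_prim k (t - a) + -1 * kern_prim k (t - b).
  by apply/funext => s; rewrite /bump mulN1r.
by rewrite mulN1r.
Qed.

Lemma bump_itv01 a b k t : a <= b <= a + 1 -> 0 <= bump a b k t <= 1.
Proof.
move=> /andP[ab ba]; rewrite /bump subr_ge0 kern_prim_nondecreasing/=; last by lra.
rewrite lerBlDl -kern_primD1 kern_prim_nondecreasing//; lra.
Qed.

Lemma bump_cvg a b t : 0 <= a <= b -> b <= 1 -> 0 < t < 1 -> t != a -> t != b ->
  bump a b k t @[k --> \oo] --> (\1_(`[a, b]%classic : set R) t : R).
Proof.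
move=> /andP[a0 ab] b1 /andP[t0 t1] ta tb.
have tail x y : 0 < x -> x <= y -> y < 1 ->
    (kern_prim k y - kern_prim k x) @[k --> \oo] --> (0 : R).
  move=> x0 xy y1; have [m m0 Hm] := hav_away x0 xy y1.
  apply/norm_cvg0P; apply: squeeze_cvgr (cvg_cst 0) (cvg_harmonic2 m^-1).
  by apply: nearW => k; rewrite normr_ge0/= (kern_prim_tail k m0).
have [lta|gta|eta] := ltgtP t a; last by rewrite eta eqxx in ta.
- rewrite indicE memNset/=; last by rewrite /= in_itv/= leNgt lta.
  (* A shift by one period brings both arguments into ]0, 1[, where the tail bound holds. *)
  have -> : (fun k => bump a b k t) =
      fun k => kern_prim k (t - a + 1) - kern_prim k (t - b + 1).
    by apply/funext => k; rewrite /bump !kern_primD1; ring.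
  by apply: tail; lra.
- have [ltb|gtb|etb] := ltgtP t b; last by rewrite etb eqxx in tb.
  + rewrite indicE mem_set/=; last by rewrite /= in_itv/= !ltW.
    have -> : (fun k => bump a b k t) =
        fun k => 1 - (kern_prim k (t - b + 1) - kern_prim k (t - a)).
      by apply/funext => k; rewrite /bump !kern_primD1; ring.
    by rewrite -[X in _ --> X]subr0; apply: cvgB; [exact: cvg_cst|apply: tail; lra].
  + rewrite indicE memNset/=; last by rewrite /= in_itv/= (leNgt t b) gtb andbF.
    by apply: tail; lra.
Qed.

End ApproximateIdentity.

(** * From the weak derivative to increments and to the speed *)

Section WeakDerivative.
Context {R : realType}.
Implicit Types (f h : R -> R) (s t x y a b : R) (k : nat).

Let mu := @lebesgue_measure R.

Lemma periodic_continuous_bounded f : continuous f -> periodic1 f ->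
  exists2 M : R, 0 < M & forall t, `|f t| <= M.
Proof.
move=> cf pf.
have [||c _ Hc] := @EVT_max _ (fun t => `|f t|) 0 1 => //.
  apply: continuous_subspaceT => t.
  by apply: (@continuous_comp _ _ _ f Num.Def.normr); [exact: cf|exact: norm_continuous].
exists (`|f c| + 1) => [|t]; first by rewrite ltr_wpDl.
have [m /andP[m0 m1] <-] := periodic1_unit pf t.
rewrite (le_trans (Hc _ _))//; last by rewrite lerDl.
by rewrite in_itv/= m0 ltW.
Qed.

(** Near [a] modulo 1 this is continuity; elsewhere [1 - hav] is bounded below and [f] is bounded.
    Integrated against [kern k], the right side becomes [e + C / (2 k + 2)]. *)
Lemma hav_dominates f a (e : R) : continuous f -> periodic1 f -> 0 < e ->
  exists2 C : R, 0 <= C & forall t, `|f t - f a| <= e + C * (1 - hav (t - a)).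
Proof.
move=> cf pf e0.
have [M M0 fM] := periodic_continuous_bounded cf pf.
have /cvgrPdist_lt/(_ e e0) /nbhs_ballP[d /= d0 Hd] := cf a.
pose d' := Num.min d (1 / 4).
have d'0 : 0 < d' by rewrite lt_min d0/=.
have d'd : d' <= d by rewrite ge_min lexx.
have d'4 : d' <= 1 / 4 by rewrite ge_min lexx orbT.
have [|||m m0 Hm] := @hav_away R d' (1 - d'); rewrite ?gtrBl//; first by lra.
have C0 : 0 <= 2 * M / m by rewrite divr_ge0 ?mulr_ge0 ?ltW.
exists (2 * M / m) => // t.
have close s : `|a - s| < d' -> `|f s - f a| <= e + 2 * M / m * (1 - hav (s - a)).
  move=> sd; rewrite (@le_trans _ _ e)//.
    by rewrite distrC ltW// Hd// /ball/= (lt_le_trans sd).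
  by rewrite lerDl mulr_ge0// subr_ge0 hav_le1.
have [j /andP[j0 j1] _] := periodic1_unit (@havD1 R) (t - a).
have saE : t - a + j%:~R = (t + j%:~R) - a by ring.
have hvj : hav (t - a) = hav (t + j%:~R - a).
  by rewrite -saE (periodic1_int (@havD1 R)).
rewrite hvj -(periodic1_int pf j t).
move: j0 j1; rewrite saE; set s := t + j%:~R => s0 s1.
have [sd|sd] := ltP (s - a) d'.
  by apply: close; rewrite distrC ger0_norm.
have [sd1|sd1] := ltP (1 - d') (s - a).
  have := close (s - 1); rewrite -(pf (s - 1)) -(havD1 (s - 1 - a)).
  have -> : s - 1 + 1 = s by ring.
  have -> : s - 1 - a + 1 = s - a by ring.
  by apply; rewrite ltr_norml; lra.
have hm := Hm (s - a); rewrite sd sd1 in hm.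
have M2 : `|f s - f a| <= 2 * M.
  by rewrite (le_trans (ler_normB _ _))// mulr_natl mulr2n lerD.
rewrite (le_trans M2)// (@le_trans _ _ (2 * M / m * (1 - hav (s - a))))//.
  by rewrite mulrAC ler_pdivlMr// ler_wpM2l ?mulr_ge0 ?(ltW M0)// hm.
by rewrite lerDr ltW.
Qed.

Lemma kern_approximates f a : continuous f -> periodic1 f ->
  \int[mu]_(t in `[0, 1]) (f t * kern k (t - a)) @[k --> \oo] --> f a.
Proof.
move=> cf pf; apply/cvgrPdist_le => e e0.
have [C C0 HC] := hav_dominates a cf pf (divr_gt0 e0 (ltr0n _ 2)).
have cs k : continuous (fun t => kern k (t - a)).
  move=> t; apply: (@continuous_comp _ _ _ (fun t => t - a) (kern k)).
    by apply: cvgB; [exact: cvg_id|exact: cvg_cst].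
  exact: kern_continuous.
have ch : continuous (fun t => 1 - hav (t - a)).
  move=> t; apply: cvgB; first exact: cvg_cst.
  apply: (@continuous_comp _ _ _ (fun t => t - a) (@hav R)).
    by apply: cvgB; [exact: cvg_id|exact: cvg_cst].
  exact: hav_continuous.
have cM (f1 f2 : R -> R) : continuous f1 -> continuous f2 ->
    continuous (fun t => f1 t * f2 t).
  by move=> c1 c2 t; apply: cvgM; [exact: c1|exact: c2].
have cB (f1 f2 : R -> R) : continuous f1 -> continuous f2 ->
    continuous (fun t => f1 t - f2 t).
  by move=> c1 c2 t; apply: cvgB; [exact: c1|exact: c2].
have cD (f1 f2 : R -> R) : continuous f1 -> continuous f2 ->
    continuous (fun t => f1 t + f2 t).
  by move=> c1 c2 t; apply: cvgD; [exact: c1|exact: c2].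
have cc (c : R) : continuous (fun _ : R => c) by move=> t; exact: cvg_cst.
have int01 (f1 : R -> R) : continuous f1 -> mu.-integrable `[0, 1] (EFin \o f1).
  by move=> c1; exact: continuous_integrable_itv.
have m01 : measurable (`[0, 1]%classic : set R) by exact: measurable_itv.
have bnd k : `|f a - \int[mu]_(t in `[0, 1]) (f t * kern k (t - a))| <=
    e / 2 + C / (2 * k%:R + 2).
  have -> : f a - \int[mu]_(t in `[0, 1]) (f t * kern k (t - a)) =
      - \int[mu]_(t in `[0, 1]) ((f t - f a) * kern k (t - a)).
    have -> : \int[mu]_(t in `[0, 1]) ((f t - f a) * kern k (t - a)) =
        \int[mu]_(t in `[0, 1]) (f t * kern k (t - a) - f a * kern k (t - a)).
      by apply: eq_Rintegral => t _; rewrite mulrBl.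
    rewrite RintegralB//; [|exact/int01/cM|exact/int01/cM/cs/cc].
    rewrite RintegralZl//; last exact/int01.
    by rewrite integral_kern mulr1 opprB.
  rewrite normrN (le_trans (le_normr_Rintegral _ _))//.
    by apply/int01/cM => //; exact: cB.
  apply: (@le_trans _ _ (\int[mu]_(t in `[0, 1])
      (e / 2 * kern k (t - a) + C * (kern k (t - a) * (1 - hav (t - a)))))).
    apply: le_Rintegral => //.
    - apply: (int01 (fun t => `|(f t - f a) * kern k (t - a)|)) => t.
      apply: (@continuous_comp _ _ _ (fun t => (f t - f a) * kern k (t - a)) Num.Def.normr).
        by apply: cM => //; exact: cB.
      exact: norm_continuous.
    - by apply: int01; apply: cD; apply: (cM) => //; exact: cM.
    - move=> t _; rewrite normrM (ger0_norm (kern_ge0 _ _)).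
      have := ler_wpM2r (kern_ge0 k (t - a)) (HC t).
      by rewrite mulrDl -[C * _ * _]mulrA [(1 - hav _) * _]mulrC.
  rewrite RintegralD//; [|by apply/int01/cM|by apply/int01/cM => //; exact: cM].
  rewrite RintegralZl//; last exact: int01 (cM _ _ (cs k) ch).
  rewrite RintegralZl//; last exact: int01 (cs k).
  by rewrite integral_kern integral_kern_hav mulr1.
have /cvgrPdist_le/(_ (e / 2)) := cvg_harmonic2 C.
move=> /(_ (divr_gt0 e0 (ltr0n _ 2))); apply: filterS => k.
rewrite sub0r normrN => h; rewrite (le_trans (bnd k))// [leRHS](splitr e) lerD2l.
exact: le_trans (ler_norm _) h.
Qed.

Lemma integral_bump_cvg h a b : 0 <= a <= b -> b <= 1 ->
  mu.-integrable `[0, 1] (EFin \o h) ->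
  \int[mu]_(t in `[0, 1]) (h t * bump a b k t) @[k --> \oo] -->
  \int[mu]_(t in `[a, b]) h t.
Proof.
move=> /andP[a0 ab] b1 ih.
have m01 : measurable (`[0, 1]%classic : set R) by exact: measurable_itv.
have mh : measurable_fun (`[0, 1]%classic : set R) h.
  by have /measurable_int/measurable_EFinP := ih.
have cb k : continuous (bump a b k) := is_derive_continuous (is_derive_bump a b k).
have bumpI k t : 0 <= bump a b k t <= 1 by apply: bump_itv01; lra.
(* The pointwise limit of the bumps is asserted off these four points only. *)
pose N : set R := [set 0] `|` [set 1] `|` [set a] `|` [set b].
have mN : measurable N by do 3?[apply: measurableU]; exact: measurable_set1.
have N0 : mu N = 0.
  apply: countable_lebesgue_measure0; apply: finite_set_countable.
  by rewrite /N !finite_setU; do !split; exact: finite_set1.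
have [|||||_ _] := @dominated_convergence _ _ R mu `[0, 1]%classic m01
  (fun k t => (h t * bump a b k t)%:E) (fun t => (h t * \1_(`[a, b]%classic) t)%:E)
  (fun t => `|(h t)%:E|%E).
- move=> k; apply/measurable_EFinP/measurable_funM => //.
  by apply: measurable_funTS; apply: continuous_measurable_fun; exact: cb.
- apply/measurable_EFinP/measurable_funM => //.
- exists N; split => // t /= /not_implyP[tI]; apply: contra_notP => tN.
  move: tI; rewrite in_itv/= => /andP[t0 t1].
  have [n0 [n1 [na nb]]] : t != 0 /\ t != 1 /\ t != a /\ t != b.
    by do !split; apply: contra_not_neq tN => ->; rewrite /N/=; tauto.
  apply/fine_cvgP; split; first by apply: nearW.
  apply: cvgM; first exact: cvg_cst.
  apply: bump_cvg => //; first by rewrite a0.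
  by rewrite !lt_neqAle eq_sym n0 n1 t0.
- exact: integrable_abse.
- apply: aeW => t k _; rewrite abse_EFin lee_fin normrM ler_piMr//.
  by have /andP[b0 b1'] := bumpI k t; rewrite ger0_norm.
have sub_ab : `[0, 1]%classic `&` `[a, b]%classic = `[a, b]%classic :> set R.
  apply/setIidr => t /=; rewrite !in_itv/= => /andP[at_ tb].
  by rewrite (le_trans a0 at_) (le_trans tb b1).
have -> : (\int[mu]_(t in `[0%R, 1%R]) (h t * \1_(`[a, b]%classic) t)%:E =
    \int[mu]_(t in `[a, b]) (h t)%:E)%E.
  rewrite -[in RHS]sub_ab integral_mkcondr; apply: eq_integral => t _.
  by rewrite /patch indicE; case: (t \in _); rewrite ?mulr1 ?mulr0.
move=> H; apply: fine_cvg; rewrite fineK//.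
apply: integrable_fin_num; first exact: measurable_itv.
apply: integrableS ih => //.
by rewrite -sub_ab; exact: subIsetl.
Qed.

(** Tested against [bump a b k], the left side tends to [f a - f b], by concentration of the kernels
    at the continuous [f], and the right side to minus the integral of [h] over [[a, b]]. *)
Lemma weak_derivative_integral f h a b : continuous f -> periodic1 f ->
  mu.-integrable `[0, 1] (EFin \o h) ->
  (forall phi, test_function phi ->
    \int[mu]_(t in `[0, 1]) (f t * derive1 phi t) =
    - \int[mu]_(t in `[0, 1]) (h t * phi t)) ->
  0 <= a <= b -> b <= 1 -> f b - f a = \int[mu]_(t in `[a, b]) h t.
Proof.
move=> cf pf ih weak ab b1.
have m01 : measurable (`[0, 1]%classic : set R) by exact: measurable_itv.
have cs k c : continuous (fun t => f t * kern k (t - c)).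
  move=> t; apply: cvgM; first exact: cf.
  apply: (@continuous_comp _ _ _ (fun t => t - c) (kern k)).
    by apply: cvgB; [exact: cvg_id|exact: cvg_cst].
  exact: kern_continuous.
have splitE k : \int[mu]_(t in `[0, 1]) (f t * derive1 (bump a b k) t) =
    \int[mu]_(t in `[0, 1]) (f t * kern k (t - a)) -
    \int[mu]_(t in `[0, 1]) (f t * kern k (t - b)).
  rewrite -RintegralB//; [|exact: continuous_integrable_itv (cs k a)|
                           exact: continuous_integrable_itv (cs k b)].
  apply: eq_Rintegral => t _.
  by rewrite (is_derive_derive1 (is_derive_bump a b k)) mulrBr.
have l1 : (fun k => \int[mu]_(t in `[0, 1]) (f t * kern k (t - a)) -
    \int[mu]_(t in `[0, 1]) (f t * kern k (t - b))) @ \oo --> f a - f b.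
  by apply: cvgB; exact: kern_approximates.
have l2 := cvgN (integral_bump_cvg ab b1 ih).
have l12 : (fun k => - \int[mu]_(t in `[0, 1]) (h t * bump a b k t)) =
    (fun k => \int[mu]_(t in `[0, 1]) (f t * kern k (t - a)) -
    \int[mu]_(t in `[0, 1]) (f t * kern k (t - b))).
  apply/funext => k; rewrite -splitE weak//; exact: bump_test.
have {}l2 : (fun k => \int[mu]_(t in `[0, 1]) (f t * kern k (t - a)) -
    \int[mu]_(t in `[0, 1]) (f t * kern k (t - b))) @ \oo -->
    - \int[mu]_(t in `[a, b]) h t.
  by rewrite -l12; exact: l2.
have fab : f a - f b = - \int[mu]_(t in `[a, b]) h t.
  exact: (cvg_unique (@Rhausdorff R) l1 l2).
lra.
Qed.

End WeakDerivative.

Section SobolevSpeed.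
Context {R : realType} {n : nat}.
Implicit Types (g h : R -> 'rV[R]_n).

Let mu := @lebesgue_measure R.

Lemma derive1_row g t :
  (forall i, derivable (fun s => g s ord0 i) t 1) ->
  forall i, derive1 g t ord0 i = derive1 (fun s => g s ord0 i) t.
Proof.
move=> dg i; rewrite !derive1E derive_mx ?mxE//.
by apply/derivable_mxP => j k; rewrite ord1.
Qed.

Lemma measurable_enorm h : (forall i, measurable_fun setT (fun t => h t ord0 i)) ->
  measurable_fun setT (fun t => enorm (h t)).
Proof.
move=> mh; apply: (@measurableT_comp _ _ _ _ _ _ (@Num.sqrt R)).
  by apply: continuous_measurable_fun; exact: sqrt_continuous.
by apply: measurable_sum => i; apply: measurable_funM; exact: mh.
Qed.

Lemma Lrho_integrable (q : R) h : 1 < q -> Lrho q h ->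
  mu.-integrable `[0, 1] (fun t => (enorm (h t))%:E).
Proof.
move=> q1 [_ mh hq].
have me := measurable_enorm mh.
have m01 : measurable (`[0, 1]%classic : set R) by exact: measurable_itv.
apply: (@le_integrable _ _ _ mu `[0, 1]%classic m01 _
    (fun t => (1 + enorm (h t) `^ q)%:E)).
- by apply/measurable_EFinP; exact: measurable_funTS.
- move=> t _; rewrite !abse_EFin lee_fin ger0_norm ?enorm_ge0//.
  rewrite ger0_norm ?addr_ge0 ?powR_ge0//.
  have [h1|h1] := leP (enorm (h t)) 1.
    by rewrite (le_trans h1)// lerDl powR_ge0.
  by rewrite (le_trans (le1r_powR (ltW h1) (ltW q1)))// lerDr.
apply: (@integrableD _ _ _ mu _ m01 (fun=> 1%:E)
  (fun t => (enorm (h t) `^ q)%:E)).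
  by apply: (@continuous_integrable_itv _ (fun=> 1)) => t; exact: cvg_cst.
apply/integrableP; split.
  apply/measurable_EFinP/measurable_funTS.
  by apply: (measurableT_comp (measurable_powR q)).
apply: le_lt_trans hq; rewrite le_eqVlt; apply/orP; left; apply/eqP.
by apply: eq_integral => t _; rewrite abse_EFin ger0_norm ?powR_ge0.
Qed.

Lemma ae_derive1_primitive (f h : R -> R) :
  mu.-integrable `[0, 1] (EFin \o h) ->
  (forall t, 0 <= t <= 1 -> f t - f 0 = \int[mu]_(s in `[0, t]) h s) ->
  {ae mu, forall t, 0 < t < 1 -> derivable f t 1 /\ derive1 f t = h t}.
Proof.
move=> ih fh.
have m01 : measurable (`[0, 1]%classic : set R) by exact: measurable_itv.
pose h01 := h \_ `[0, 1]%classic.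
have ih01 : mu.-integrable setT (EFin \o h01).
  rewrite (_ : EFin \o h01 = (EFin \o h) \_ `[0, 1]%classic).
    exact: (@integrable_mkcond _ _ R mu _ (EFin \o h) m01).1 ih.
  by rewrite restrict_EFin.
have := @FTC1 R h01 (BLeft 0) _ (integrable_locally m01 ih) => /(_ _)/wrap[y|].
  by apply: integrableS ih01 => //; exact: measurable_itv.
apply: filterS; first exact: (ae_filter_ringOfSetsType mu).
move=> t Ht /andP[t0 t1].
have [dF FE] := Ht t0.
pose G (s : R) : R := f 0 + \int[mu]_(r in `[0, s]) h01 r.
have near_f : {near t, f =1 G}.
  near=> s.
  have sI : 0 < s < 1.
    by near: s; apply: near_in_itvoo; rewrite in_itv/= t0.
  have s01 : 0 <= s <= 1 by lra.
  have I01 : \int[mu]_(r in `[0, s]) h01 r = \int[mu]_(r in `[0, s]) h r.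
    apply: eq_Rintegral => r; rewrite inE/= in_itv/= => /andP[r0 rs].
    by rewrite /h01 patchE mem_set//= in_itv/= r0 (le_trans rs)//; lra.
  by rewrite /G I01 -fh// addrC subrK.
have near_f' : {near t, G =1 f}.
  by apply: filterS near_f => s; exact: esym.
have dF' := DeriveDef dF (etrans (esym (derive1E _ _)) FE).
have dG : is_derive t 1 G (h t).
  have := is_derive_addf (is_derive_cstf (f 0) t) dF'.
  by rewrite add0r /h01 patchE mem_set//= in_itv/= !ltW.
have [df fE] := near_eq_is_derive near_f' dG.
by rewrite derive1E.
Unshelve. all: by end_near. Qed.

(** [v] is the norm of the weak derivative on a subset of full measure of ]0, 1[ where the pointwise
    derivative exists and equals it, and 0 elsewhere, so that it stays below the speed even where
    [derive1] is a default value. *)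
Lemma sobolev_speed_minorant (q : R) g h : 1 < q -> continuous g -> periodic1 g ->
  Lrho q h -> weak_derivative g h -> exists v, speed_minorant g v.
Proof.
move=> q1 cg pg Lh wgh; have [_ mh _] := Lh.
have m01 : measurable (`[0, 1]%classic : set R) by exact: measurable_itv.
have ih := Lrho_integrable q1 Lh.
have me := measurable_enorm mh.
have ihi i : mu.-integrable `[0, 1] (EFin \o (fun t => h t ord0 i)).
  apply: le_integrable ih => //.
    by apply/measurable_EFinP; apply: measurable_funTS; exact: mh.
  move=> t _; rewrite !abse_EFin lee_fin (ger0_norm (enorm_ge0 _)).
  exact: coord_le_enorm.
have cgi i : continuous (fun t => g t ord0 i).
  move=> t; apply: (@continuous_comp _ _ _ g (fun M : 'rV[R]_n => M ord0 i)).
    exact: cg.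
  exact: coord_continuous.
have gi i a b : 0 <= a <= b -> b <= 1 ->
    g b ord0 i - g a ord0 i = \int[mu]_(t in `[a, b]) h t ord0 i.
  move=> ab b1; apply: (weak_derivative_integral (f := fun t => g t ord0 i)) => //.
  - by move=> t; rewrite pg.
  - exact: wgh.
have [N [mN N0 HN]] : {ae mu, forall t, forall i, 0 < t < 1 ->
    derivable (fun s => g s ord0 i) t 1 /\
    derive1 (fun s => g s ord0 i) t = h t ord0 i}.
  apply: filter_forall => i; apply: ae_derive1_primitive => // t /andP[t0 t1].
  by apply: gi; rewrite ?lexx ?t0.
pose D : set R := `]0, 1[%classic `\` N.
have mD : measurable D by apply: measurableD => //; exact: measurable_itv.
pose v := (fun t => enorm (h t)) \_ D.
have gD t : D t -> derive1 g t = h t.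
  move=> [/= tI Nt].
  have Ht i : derivable (fun s => g s ord0 i) t 1 /\
      derive1 (fun s => g s ord0 i) t = h t ord0 i.
    apply: contrapT => Hi; apply: Nt; apply: HN => /= HH; apply: Hi.
    by apply: HH; move: tI; rewrite in_itv.
  by apply/rowP => i; rewrite derive1_row; [have [] := Ht i|move=> j; have [] := Ht j].
exists v; split.
- by apply/(measurable_restrictT _ _).1 => //; exact: measurable_funTS.
- move=> t; rewrite /v patchE; case: ifPn => [/set_mem Dt|_].
    by rewrite gD// lexx enorm_ge0.
  by rewrite lexx enorm_ge0.
move=> a b a0 ab b1.
have mab : measurable (`[a, b]%classic : set R) by exact: measurable_itv.
have sub_ab : `[a, b]%classic `<=` (`[0, 1]%classic : set R).
  move=> t /=; rewrite !in_itv/= => /andP[at_ tb].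
  by rewrite (le_trans a0 at_) (le_trans tb b1).
have ihab : mu.-integrable `[a, b] (fun t => (enorm (h t))%:E) by exact: integrableS ih.
have ihiab i : mu.-integrable `[a, b] (EFin \o (fun t => h t ord0 i)).
  by apply: integrableS (ihi i).
have -> : (\int[mu]_(t in `[a, b]) (v t)%:E =
    \int[mu]_(t in `[a, b]) (enorm (h t))%:E)%E.
  apply: ge0_ae_eq_integral => //.
  - apply/measurable_EFinP/measurable_funTS.
    by apply/(measurable_restrictT _ _).1 => //; exact: measurable_funTS.
  - by apply/measurable_EFinP; exact: measurable_funTS.
  - by move=> t _; rewrite /v lee_fin patchE; case: ifPn; rewrite ?enorm_ge0.
  - by move=> t _; rewrite lee_fin enorm_ge0.
  exists (N `|` [set 0] `|` [set 1]); split.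
  - by do 2?[apply: measurableU] => //; exact: measurable_set1.
  - rewrite !measureU0//; do ?[exact: lebesgue_measure_set1|exact: measurable_set1].
    by apply: measurableU => //; exact: measurable_set1.
  move=> t /= /not_implyP[tI]; apply: contra_notP => tN.
  congr EFin; rewrite /v patchE mem_set//; split; last by apply: contra_not tN; tauto.
  have t0 : t != 0 by apply: contra_not_neq tN => ->; rewrite /=; tauto.
  have t1 : t != 1 by apply: contra_not_neq tN => ->; rewrite /=; tauto.
  move: (sub_ab _ tI); rewrite /= !in_itv/= => /andP[t0' t1'].
  by rewrite !lt_neqAle eq_sym t0 t1 t0'.
have fin : \int[mu]_(t in `[a, b]) enorm (h t) =
  fine (\int[mu]_(t in `[a, b]) (enorm (h t))%:E)%E by [].
have finI : (\int[mu]_(t in `[a, b]) (enorm (h t))%:E)%E \is a fin_num.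
  exact: integrable_fin_num.
rewrite -(fineK finI) -fin lee_fin ler_pdivrMr//.
apply: (@le_trans _ _ (n%:R * \int[mu]_(t in `[a, b]) enorm (h t))).
  apply: enorm_le_coord => i; rewrite !mxE gi// ?a0//.
  rewrite (le_trans (le_normr_Rintegral _ _))//; apply: le_Rintegral => //.
    exact: integrable_norm.
  by move=> t _; exact: coord_le_enorm.
rewrite mulrC ler_wpM2l ?ler_nat//.
by apply: Rintegral_ge0 => t _; exact: enorm_ge0.
Qed.

End SobolevSpeed.

(** * Blow-up of the energy at a non-injective limit *)

Section NonInjectiveLimit.
Context {R : realType} {n : nat}.
Implicit Types (g : R -> 'rV[R]_n).

Let mu := @lebesgue_measure R.

(** On an open interval of constancy the derivative vanishes, and such an interval is not a null
    set. *)
Lemma arc_length_nonconstant g a b : arc_length_parametrized g -> a < b ->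
  exists2 t, a <= t <= b & g t != g a.
Proof.
move=> [N [mN N0 HN]] ab; apply: contrapT => Hg.
have gab t : a <= t <= b -> g t = g a.
  by move=> tI; apply/eqP; apply: contrapT => /negP gt; apply: Hg; exists t.
have mab : measurable (`]a, b[%classic : set R) by exact: measurable_itv.
have : (mu `]a, b[%classic <= mu N)%E.
  apply: le_measure; rewrite ?inE//.
  move=> t /= tI; apply: HN => /=.
  have -> : derive1 g t = 0.
    rewrite derive1E (near_eq_derive (g := cst (g a))) ?derive_cst//.
    apply: filterS (near_in_itvoo tI) => s.
    by rewrite in_itv/= => /andP[/ltW as_ /ltW sb]; rewrite gab// as_.
  by rewrite enorm0 => /eqP; rewrite eq_sym oner_eq0.
rewrite [leRHS]N0 /mu lebesgue_measure_itv/= lte_fin ab -EFinD lee_fin.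
by rewrite leNgt subr_gt0 ab.
Qed.

Lemma uniform_cvg_enorm (gam : nat -> R -> 'rV[R]_n) gam_oo (e : R) :
  {uniform, gam @ \oo --> gam_oo} -> 0 < e ->
  \forall k \near \oo, forall t, enorm (gam k t - gam_oo t) <= e.
Proof.
move=> cg e0; pose d := e / n.+1%:R.
have d0 : 0 < d by rewrite divr_gt0.
have : nbhs (gam_oo : {uniform R -> 'rV[R]_n})
    [set h : R -> 'rV[R]_n | forall t, enorm (h t - gam_oo t) <= e].
  apply/uniform_nbhs; exists [set xy | ball xy.1 d xy.2]; split.
    exact: (@entourage_ball R 'rV[R]_n (PosNum d0)).
  move=> h /= Hh t; have := Hh t I; rewrite -ball_normE/= => /ltW hd.
  rewrite enorm_distC (le_trans (enorm_le_norm _))//.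
  rewrite (le_trans (ler_wpM2l _ hd))// /d mulrCA ler_piMr ?(ltW e0)//.
  by rewrite ler_pdivrMr// mul1r ler_nat.
by move=> /cg.
Qed.

Theorem energy_blowup (p q : R) (gam : nat -> R -> 'rV[R]_n) gam_oo :
  1 < q -> 2 / 3 * q + 1 < p ->
  (forall k, embedded (gam k)) ->
  (forall k, exists v, speed_minorant (gam k) v) ->
  periodic1 gam_oo -> arc_length_parametrized gam_oo ->
  ~ injective_curve gam_oo -> {uniform, gam @ \oo --> gam_oo} ->
  intM p q (gam k) @[k --> \oo] --> +oo%E.
Proof.
move=> q1 pq eg sg pg al ninj cg; apply/cvgeyPge => A.
have [s [t [s0 st t1 gst]]] : exists s t : R,
    [/\ 0 <= s, s < t, t < 1 & gam_oo s = gam_oo t].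
  apply: contrapT => H; apply: ninj => s t; rewrite !in_itv/=.
  move=> /andP[s0 s1] /andP[t0 t1] gst; apply: contrapT => /eqP.
  by rewrite neq_lt => /orP[] ?; apply: H; [exists s, t|exists t, s].
have E0 : 0 < `|A| + 1 by rewrite ltr_wpDl.
have [r r0 Hr] := @energy_flat R n p q (`|A| + 1) (1 / 2) q1 pq E0 ltac:(lra).
have [t1' t1I g1] := arc_length_nonconstant al st.
have ts1 : t < s + 1 by lra.
have [t2' t2I g2] := arc_length_nonconstant al ts1.
(* Both arcs of the limit at the double point reach distance [2 * rho]. A curve within [rho / 8] of
   it has its two points at most [rho / 4] apart, yet both arcs still go beyond [rho], so each
   alternative of [near_points_short_arc] fails. *)
pose rho := Num.min (r / 2) (Num.min (enorm (gam_oo t1' - gam_oo s))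
  (enorm (gam_oo t2' - gam_oo t)) / 2).
have rho0 : 0 < rho.
  by rewrite lt_min !divr_gt0// lt_min !enorm_gt0 !subr_eq0 g1 g2.
have rhor : 2 * rho <= r.
  have : rho <= r / 2 by rewrite ge_min lexx.
  lra.
have rho1 : 2 * rho <= enorm (gam_oo t1' - gam_oo s).
  rewrite mulrC -ler_pdivlMr// /rho ge_min; apply/orP; right.
  by rewrite ler_pM2r// ge_min lexx.
have rho2 : 2 * rho <= enorm (gam_oo t2' - gam_oo t).
  rewrite mulrC -ler_pdivlMr// /rho ge_min; apply/orP; right.
  by rewrite ler_pM2r// ge_min lexx orbT.
have := uniform_cvg_enorm cg (divr_gt0 rho0 (ltr0n _ 8)).
apply: filterS => k Hk.
rewrite leNgt; apply/negP => EA.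
have {}EA : (intM p q (gam k) <= (`|A| + 1)%:E)%E.
  by rewrite (le_trans (ltW EA))// lee_fin (le_trans (ler_norm A))// lerDl.
have [v gv] := sg k; have [ck pk _] := eg k.
have Hf := Hr _ _ ck pk gv EA.
have near a b : enorm (gam k a - gam k b) <= enorm (gam_oo a - gam_oo b) + rho / 4.
  have -> : gam k a - gam k b =
    (gam k a - gam_oo a) + (gam_oo a - gam_oo b) - (gam k b - gam_oo b).
    by apply/rowP => i; rewrite !mxE; ring.
  rewrite (le_trans (enormD _ _))// enormN.
  have := enormD (gam k a - gam_oo a) (gam_oo a - gam_oo b).
  by have := Hk a; have := Hk b; lra.
have far a b : enorm (gam_oo a - gam_oo b) - rho / 4 <= enorm (gam k a - gam k b).
  have -> : gam_oo a - gam_oo b =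
    (gam k a - gam k b) - (gam k a - gam_oo a) + (gam k b - gam_oo b).
    by apply/rowP => i; rewrite !mxE; ring.
  rewrite lerBlDr (le_trans (enormD _ _))//.
  have := enormD (gam k a - gam k b) (- (gam k a - gam_oo a)); rewrite enormN.
  by have := Hk a; have := Hk b; lra.
have [|||H|H] := near_points_short_arc (u := s) (w := t) (eg k) Hf _ rho0 rhor.
- by apply/andP; split; lra.
- by apply/andP; split; lra.
- have := near t s; rewrite gst subrr enorm0; lra.
- by have := H _ t1I; have := far t1' s; lra.
- have := H _ t2I; have := far t2' s; rewrite gst; lra.
Qed.

End NonInjectiveLimit.

(** * Arc length of closed curves of class C1 *)

Section ArcLength.
Context {R : realType} {n : nat}.
Implicit Types (g c : R -> 'rV[R]_n).

Let mu := @lebesgue_measure R.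

Lemma C1_coord g : C1_curve g -> forall i (t : R),
  is_derive t 1 (fun s => g s ord0 i) (derive1 g t ord0 i).
Proof.
move=> [dg _] i t; have /derivable_mxP di := dg t.
apply: DeriveDef; first exact: di.
by rewrite -derive1E derive1_row// => j; exact: di.
Qed.

Lemma C1_speed_continuous g : C1_curve g ->
  continuous (fun t => enorm (derive1 g t)).
Proof.
move=> [_ cg].
have -> : (fun t => enorm (derive1 g t)) = (fun t => enorm (derive1 g t - 0)).
  by apply/funext => t; rewrite subr0.
exact: enorm_dist_continuous.
Qed.

Definition arc_length_function g (l : R -> R) : Prop :=
  forall t : R, is_derive t 1 l (enorm (derive1 g t)).

Lemma is_derive_const0 (f : R -> R) :
  (forall t : R, is_derive t 1 f 0) -> forall s t, f s = f t.
Proof.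
move=> df; have le s t : s <= t -> f s = f t.
  move=> st; apply/eqP; rewrite eq_le.
  rewrite (is_derive_nondecreasing df)//= -lerN2.
  have dN (u : R) : is_derive u 1 (fun v => -1 * f v) 0.
    by have := is_derive_scalef (-1) (df u); rewrite mulr0.
  by have := is_derive_nondecreasing dN (fun _ _ => lexx 0) st; rewrite !mulN1r.
by move=> s t; have [/le//|/ltW/le->] := leP s t.
Qed.

Section Properties.
Variables (g : R -> 'rV[R]_n) (l : R -> R) (L : R).
Hypotheses (g1 : C1_curve g) (eg : embedded g) (gl : arc_length_function g l).
Hypothesis gL : curve_length g = L%:E.

Let pg : periodic1 g. Proof. by have [] := eg. Qed.

Let cg : continuous g. Proof. by have [] := eg. Qed.

Lemma arc_length_le s t : s <= t -> l s <= l t.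
Proof.
by move=> st; apply: (is_derive_nondecreasing gl) => // u _; exact: enorm_ge0.
Qed.

Lemma arc_lengthB : l 1 - l 0 = L.
Proof.
apply: EFin_inj; rewrite -gL; apply/esym.
exact: (integral_primitive ler01 (C1_speed_continuous g1) gl).
Qed.

Let derive1_periodic t : derive1 g (t + 1) = derive1 g t.
Proof.
apply/rowP => i.
have d1 := is_derive_addf (is_derive_idf t) (is_derive_cstf 1 t).
have := @is_derive_compf R (fun s => g s ord0 i) (fun s => s + 1) t _ _
  (C1_coord g1 i (t + 1)) d1.
rewrite addr0 mulr1.
have -> : (fun s => g (s + 1) ord0 i) = (fun s => g s ord0 i).
  by apply/funext => s; rewrite pg.
by move=> [_ <-]; have [_ <-] := C1_coord g1 i t.
Qed.

Lemma arc_lengthD1 t : l (t + 1) = l t + L.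
Proof.
have dl (s : R) : is_derive s 1 (fun u => l (u + 1) + -1 * l u) 0.
  have d1 := is_derive_addf (is_derive_idf s) (is_derive_cstf 1 s).
  have := is_derive_addf 
    (@is_derive_compf R l (fun u => u + 1) s _ _ (gl (s + 1)) d1)
    (is_derive_scalef (-1) (gl s)).
  by rewrite addr0 mulr1 derive1_periodic mulN1r subrr.
have := is_derive_const0 dl t 0; rewrite add0r -arc_lengthB; lra.
Qed.

Lemma arc_length_int (m : int) t : l (t + m%:~R) = l t + m%:~R * L.
Proof.
have pn (k : nat) s : l (s + k%:R) = l s + k%:R * L.
  elim: k s => [|k IH] s; first by rewrite mul0r !addr0.
  by rewrite -natr1 addrA arc_lengthD1 IH mulrDl mul1r addrA.
case: m => k; first exact: pn.
have := pn k.+1 (t - k.+1%:R); rewrite subrK NegzE mulrNz => ->.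
by rewrite mulNr addrK.
Qed.

Lemma chord_le_arc i s t : s <= t -> `|g t ord0 i - g s ord0 i| <= l t - l s.
Proof.
move=> st.
have dD (a u : R) : is_derive u 1 (fun v => l v + a * g v ord0 i)
    (enorm (derive1 g u) + a * derive1 g u ord0 i).
  exact: is_derive_addf (gl u) (is_derive_scalef a (C1_coord g1 i u)).
have le_ u := coord_le_enorm (derive1 g u) i.
have h1 := is_derive_nondecreasing (dD 1) _ st.
have h2 := is_derive_nondecreasing (dD (-1)) _ st.
rewrite ler_norml; apply/andP; split.
- suff : l s + 1 * g s ord0 i <= l t + 1 * g t ord0 i by lra.
  by apply: h1 => u _; have := le_ u; rewrite ler_norml; lra.
- suff : l s + -1 * g s ord0 i <= l t + -1 * g t ord0 i by lra.
  by apply: h2 => u _; have := le_ u; rewrite ler_norml; lra.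
Qed.

Lemma arc_length_eq s t : l s = l t -> g s = g t.
Proof.
move=> lst; apply/rowP => i; apply/eqP; rewrite -subr_eq0 -normr_le0.
by have [/chord_le_arc|/ltW/chord_le_arc] := leP t s => /(_ i);
  rewrite lst subrr// distrC.
Qed.

Hypothesis L0 : 0 < L.

(** Strict monotonicity comes from embeddedness: equal arc length gives equal points, hence
    parameters differing by an integer [m], and then [m * L = 0]. *)
Lemma arc_length_inj s t : l s = l t -> s = t.
Proof.
move=> lst; have [m sE] := embedded_int eg (arc_length_eq lst).
move: lst; rewrite sE arc_length_int => lst.
have /eqP : m%:~R * L = 0 by lra.
rewrite mulf_eq0 (gt_eqF L0) orbF => /eqP ->.
by rewrite addr0.
Qed.

Lemma arc_length_lt s t : l s < l t -> s < t.
Proof. by move=> lst; rewrite ltNge; apply: contraTN lst => /arc_length_le; rewrite leNgt. Qed.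

Lemma arc_length_surj s : exists t, l t = s.
Proof.
pose m := Num.floor ((s - l 0) / L).
have /andP[m1 m2] := floor_itv ((s - l 0) / L); rewrite -/m in m1 m2.
have cl : continuous l := is_derive_continuous gl.
have [||t _ <-] := @ivt_le _ l (0 + m%:~R) (0 + (m + 1)%:~R) s cl; last by exists t.
  by rewrite !add0r ler_int lerDl.
rewrite !arc_length_int; move: m1 m2; rewrite ler_pdivlMr// ltr_pdivrMr//; lra.
Qed.

End Properties.

Lemma limit_direction g (e : 'rV[R]_n) (d x w : R) : 0 <= d -> x < w ->
  derivable g x 1 ->
  (forall t, x <= t <= w ->
    enorm (g t - g x - enorm (g t - g x) *: e) <= d * enorm (g t - g x)) ->
  enorm (derive1 g x - enorm (derive1 g x) *: e) <= d * enorm (derive1 g x).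
Proof.
move=> d0 xw dg He; apply/ler_addgt0Pr => eps eps0.
(* One term for each error: [d] for the norm on the right, 1 for [D - q], and [enorm e] for the
   change of norm in front of [e]. *)
pose C := d + 1 + enorm e.
have C0 : 0 < C by rewrite ltr_wpDr ?enorm_ge0// ltr_wpDl.
pose eps' := eps / C / n.+1%:R.
have eps'0 : 0 < eps' by rewrite !divr_gt0.
set D := derive1 g x.
have [r r0 Hr] : exists2 r : R, 0 < r & forall u, `|u| < r -> u != 0 ->
    enorm (D - u^-1 *: (g (u + x) - g x)) <= eps / C.
  have /cvgrPdist_le/(_ _ eps'0)/nbhs_ballP[r /= r0 Hr] := dg.
  exists r => // u ur u0.
  have := Hr u; rewrite /ball/= sub0r normrN => /(_ ur u0).
  rewrite -/(derive g x 1) -derive1E -/D /GRing.scale/= mulr1 => h.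
  rewrite (le_trans (enorm_le_norm _))// (le_trans (ler_wpM2l _ h))//.
  rewrite /eps' mulrCA ler_piMr ?divr_ge0 ?(ltW eps0) ?(ltW C0)//.
  by rewrite ler_pdivrMr// mul1r ler_nat.
pose u := Num.min (r / 2) (w - x).
have u0 : 0 < u by rewrite lt_min divr_gt0// subr_gt0.
have ur : `|u| < r.
  rewrite gtr0_norm//; have : u <= r / 2 by rewrite ge_min lexx.
  lra.
have ux : u <= w - x by rewrite ge_min lexx orbT.
pose a := g (u + x) - g x; pose q := u^-1 *: a.
have qD : enorm (D - q) <= eps / C by apply: Hr; rewrite // gt_eqF.
have qe : enorm (q - enorm q *: e) <= d * enorm q.
  rewrite /q enormZ gtr0_norm ?invr_gt0// -scalerA -scalerBr enormZ.
  rewrite gtr0_norm ?invr_gt0// mulrCA ler_wpM2l ?invr_ge0 ?(ltW u0)//.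
  by apply: He; apply/andP; split; lra.
have nD : enorm D <= enorm q + eps / C.
  by rewrite -{1}(subrK q D) addrC (le_trans (enormD _ _))// lerD2l.
have nq : enorm q <= enorm D + eps / C.
  rewrite -{1}(subrK D q) addrC (le_trans (enormD _ _))// lerD2l.
  by rewrite enorm_distC.
have -> : D - enorm D *: e =
    (q - enorm q *: e) + (D - q) + (enorm q - enorm D) *: e.
  by apply/rowP => i; rewrite !mxE; ring.
rewrite (le_trans (enormD _ _))// enormZ.
have := enormD (q - enorm q *: e) (D - q).
have e0 := enorm_ge0 e.
have h1 : `|enorm q - enorm D| * enorm e <= eps / C * enorm e.
  by rewrite ler_wpM2r// ler_norml; lra.
have h2 : d * enorm q <= d * enorm D + d * (eps / C).
  by rewrite -mulrDr ler_wpM2l.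
have : eps = d * (eps / C) + eps / C + eps / C * enorm e.
  transitivity (eps / C * C); first by rewrite divfK ?gt_eqF.
  have CE : C = d + 1 + enorm e by [].
  by rewrite {2}CE; ring.
lra.
Qed.

End ArcLength.

(** * Arc length parametrizations with uniform straightness and separation *)

Section TameParametrization.
Context {R : realType} {n : nat}.
Implicit Types (g c : R -> 'rV[R]_n).

Lemma unit_coord (e : 'rV[R]_n) : enorm e = 1 ->
  exists i, n.+1%:R^-1 <= `|e ord0 i|.
Proof.
move=> e1; apply: contrapT => H.
have : enorm e <= n%:R * n.+1%:R^-1.
  apply: enorm_le_coord => i; rewrite leNgt; apply/negP => /ltW h.
  by apply: H; exists i.
by rewrite e1 ler_pdivlMr// mul1r ler_nat ltnn.
Qed.

(** Stated in coordinates because curves are compared in the maximum norm. Straightness reaches up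
    to length [h] while separation starts at [h / 2]; the overlap leaves room for rounding
    parameters to a grid. *)
Definition tame (L h rho eta : R) c : Prop :=
  [/\ forall s : R, c (s + L) = c s,
      forall i (s t : R), s <= t -> `|c t ord0 i - c s ord0 i| <= t - s,
      forall s0 : R, exists2 e : 'rV[R]_n, enorm e = 1 &
        forall i (s t : R), s0 <= s -> s <= t -> t <= s0 + h ->
          `|c t ord0 i - c s ord0 i - (t - s) * e ord0 i| <= eta * (t - s) &
      forall s t : R, h / 2 < t - s -> t - s < L - h / 2 ->
        rho <= enorm (c t - c s)].

Section FromFlatness.
Variables (g : R -> 'rV[R]_n) (l : R -> R) (L d r : R).
Hypotheses (g1 : C1_curve g) (eg : embedded g) (gl : arc_length_function g l).
Hypotheses (gL : curve_length g = L%:E) (L0 : 0 < L).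
Hypotheses (gf : flat_at_scale g d r) (d0 : 0 <= d < 1).

Lemma arc_linear u w : u < w < u + 1 ->
  (forall t, u <= t <= w -> enorm (g t - g u) <= r / 2) ->
  exists2 e : 'rV[R]_n, enorm e = 1 & forall i a b, u <= a -> a <= b -> b <= w ->
    `|g b ord0 i - g a ord0 i - (l b - l a) * e ord0 i| <= 2 * d * (l b - l a).
Proof.
move=> uw Hr; have [e e1 He] := arc_direction eg gf d0 uw Hr.
have /andP[d0' _] := d0.
have dir x : u < x < w -> enorm (derive1 g x - enorm (derive1 g x) *: e) <=
    2 * d * enorm (derive1 g x).
  move=> /andP[ux xw]; apply: (limit_direction _ xw) => //.
  - by rewrite mulr_ge0.
  - by have [] := g1.
  - by move=> t /andP[xt tw]; apply: He => //; exact: ltW.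
exists e => // i a b ua ab bw.
(* For k = 1 and k = -1 this derivative is nonnegative on the arc; the two monotonicities are the
   two sides of the bound, which is affine in arc length rather than in the parameter. *)
have dD (k x : R) : is_derive x 1
    (fun s => (2 * d + - k * e ord0 i) * l s + k * g s ord0 i)
    ((2 * d + - k * e ord0 i) * enorm (derive1 g x) + k * derive1 g x ord0 i).
  exact: is_derive_addf (is_derive_scalef _ (gl x))
    (is_derive_scalef k (C1_coord g1 i x)).
have coord x : a < x < b ->
    `|derive1 g x ord0 i - enorm (derive1 g x) * e ord0 i| <=
    2 * d * enorm (derive1 g x).
  move=> /andP[ax xb]; apply: le_trans (dir x _); last first.
    by rewrite (le_lt_trans ua ax) (lt_le_trans xb bw).
  have := coord_le_enorm (derive1 g x - enorm (derive1 g x) *: e) i.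
  by rewrite !mxE.
have := is_derive_nondecreasing (dD 1) _ ab => /(_ _)/wrap[x xI|h1].
  by have := coord x xI; rewrite ler_norml; lra.
have := is_derive_nondecreasing (dD (-1)) _ ab => /(_ _)/wrap[x xI|h2].
  by have := coord x xI; rewrite ler_norml; lra.
by rewrite ler_norml; apply/andP; split; lra.
Qed.

Lemma tame_parametrization (h : R) : 2 * d <= (2 * n.+1%:R)^-1 -> 0 < h < L ->
  n.+1%:R * h <= r / 2 ->
  exists2 c : R -> 'rV[R]_n, tame L h (h / (4 * n.+1%:R)) (2 * d) c &
    range c = range g.
Proof.
move=> dn /andP[h0 hL] hr.
have [cg pg _] := eg.
have [tau tauE] := choice (arc_length_surj g1 eg gl gL L0).
have le_inv a b : l a <= l b -> a <= b.
  rewrite le_eqVlt => /predU1P[/(arc_length_inj g1 eg gl gL L0)->//|].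
  by move=> /(arc_length_lt gl)/ltW.
have ctau t : g (tau (l t)) = g t.
  exact: (arc_length_eq g1 gl (tauE _)).
have lip i s t : s <= t -> `|g (tau t) ord0 i - g (tau s) ord0 i| <= t - s.
  by move=> st; rewrite -{2}(tauE t) -{2}(tauE s) (chord_le_arc g1 gl)// le_inv// !tauE.
have lipE s t : s <= t -> enorm (g (tau t) - g (tau s)) <= n.+1%:R * (t - s).
  move=> st; apply: le_trans (enorm_le_coord _) _ => [i|].
    by rewrite !mxE; exact: lip st.
  by rewrite ler_wpM2r ?subr_ge0// ler_nat.
have tau_lt s t : s < t -> tau s < tau t.
  by move=> st; apply: (arc_length_lt gl); rewrite !tauE.
have tau_le s t : s <= t -> tau s <= tau t by move=> st; apply: le_inv; rewrite !tauE.
have tau_lt1 s t : t < s + L -> tau t < tau s + 1.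
  move=> st; apply: (arc_length_lt gl).
  by rewrite (arc_lengthD1 g1 eg gl gL) !tauE.
have n0 : 0 < n.+1%:R :> R by [].
have n1 : 1 <= n.+1%:R :> R by rewrite ler1n.
pose rho := h / (2 * n.+1%:R).
have rho0 : 0 < rho by rewrite divr_gt0// mulr_gt0.
have rhoE : n.+1%:R * rho = h / 2 by rewrite /rho; field; rewrite addrC natr1 pnatr_eq0.
have rho_h : rho <= h / 2 by rewrite -rhoE ler_peMl// ltW.
have h_r : h <= r / 2 by rewrite (le_trans _ hr)// ler_peMl// ltW.
(* Some coordinate of the direction is at least 1 / (n + 1). With [lw = l w - l u], this gives lw /
   (n + 1) <= 2 d lw + rho / 2, and the bound on [d] absorbs half of the left side, so lw <= (n + 1)
   rho = h / 2. *)
have short u w : u < w < u + 1 ->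
    (forall t, u <= t <= w -> enorm (g t - g u) <= r / 2) ->
    enorm (g w - g u) < rho / 2 -> l w - l u <= h / 2.
  move=> uw Hr gwu; have [e e1 He] := arc_linear uw Hr.
  have [i ei] := unit_coord e1.
  have /andP[uw1 _] := uw.
  have := He i u w (lexx _) (ltW uw1) (lexx _).
  have lw : 0 <= l w - l u by rewrite subr_ge0 (arc_length_le gl)// ltW.
  have := coord_le_enorm (g w - g u) i; rewrite !mxE => g_i He_i.
  have : (l w - l u) * `|e ord0 i| <= 2 * d * (l w - l u) + rho / 2.
    rewrite -{1}(ger0_norm lw) -normrM.
    have -> : (l w - l u) * e ord0 i = (g w ord0 i - g u ord0 i) -
      (g w ord0 i - g u ord0 i - (l w - l u) * e ord0 i) by ring.
    rewrite (le_trans (ler_normB _ _))// addrC lerD// (le_trans g_i)//.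
    exact: ltW.
  have h1 : (l w - l u) * n.+1%:R^-1 <= (l w - l u) * `|e ord0 i|.
    by rewrite ler_wpM2l.
  have h2 : 2 * d * (l w - l u) <= (2 * n.+1%:R)^-1 * (l w - l u).
    by rewrite ler_wpM2r.
  have h3 : (2 * n.+1%:R)^-1 * (l w - l u) = (l w - l u) * n.+1%:R^-1 / 2.
    by field; rewrite addrC natr1 pnatr_eq0.
  rewrite h3 in h2; move: h1 h2; set X := _ / _ => h1 h2 h4.
  have : X <= rho by lra.
  by rewrite /X ler_pdivrMr// mulrC rhoE.
exists (g \o tau); last first.
  apply/seteqP; split => [_ [s _ <-]|_ [t _ <-]]; first by exists (tau s).
  by exists (l t) => //=; exact: ctau.
have per s : g (tau (s + L)) = g (tau s).
  apply: etrans (pg (tau s)); apply: (arc_length_eq g1 gl).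
  by rewrite (arc_lengthD1 g1 eg gl gL) !tauE.
split=> [s|i s t|s0|s t st1 st2] /=.
- exact: per.
- exact: lip.
- have s0h : s0 < s0 + h by rewrite ltrDl.
  have [||e e1 He] := @arc_linear (tau s0) (tau (s0 + h)).
  + by rewrite tau_lt//= tau_lt1// ltrD2l.
  + move=> t /andP[t1 t2]; rewrite -[t](arc_length_inj g1 eg gl gL L0 (tauE (l t))).
    have lt0 : s0 <= l t by rewrite -(tauE s0) (arc_length_le gl).
    have lth : l t <= s0 + h by rewrite -(tauE (s0 + h)) (arc_length_le gl).
    rewrite (le_trans (lipE _ _ lt0))// (le_trans _ hr)// ler_wpM2l//.
    by rewrite lerBlDl.
  exists e => // i s t s0s st th.
  by have := He i _ _ (tau_le _ _ s0s) (tau_le _ _ st) (tau_le _ _ th); rewrite !tauE.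
have st : s < t by rewrite -subr_gt0 (lt_trans _ st1)// divr_gt0.
have h20 : 0 < h / 2 by rewrite divr_gt0.
have stL : t < s + L by lra.
rewrite leNgt; apply/negP => close.
have d1 : 0 <= d <= 1 / 2.
  have /andP[d0' _] := d0.
  have h1 : (2 * n.+1%:R)^-1 <= 1 :> R.
    by rewrite invf_le1 ?mulr_gt0// -[leLHS]mul1r ler_pM// ler1n.
  by have := le_trans dn h1; lra.
have rho_r : 2 * rho <= r by lra.
have close' : enorm (g (tau t) - g (tau s)) < rho / 2.
  apply: lt_le_trans close _; rewrite le_eqVlt; apply/orP; left; apply/eqP.
  by rewrite /rho; field; rewrite addrC natr1 pnatr_eq0.
have sut : tau s <= tau t <= tau s + 1 by rewrite !ltW ?tau_lt ?tau_lt1.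
have [H|H] := near_points_short_arc eg gf d1 rho0 rho_r sut close'.
- have := short (tau s) (tau t); rewrite !tauE tau_lt// tau_lt1// => /(_ isT) sh.
  have : t - s <= h / 2.
    apply: sh => // u uI; apply: le_trans (ltW (H u uI)) _; lra.
  lra.
(* The complementary arc, from [tau t] to [tau s + 1], has length [s + L - t]. *)
- have ts1 : tau t < tau s + 1 < tau t + 1 by rewrite tau_lt1// ltrD2r tau_lt.
  have := short _ _ ts1; rewrite (arc_lengthD1 g1 eg gl gL) !tauE pg => sh.
  have : s + L - t <= h / 2.
    apply: sh; last by rewrite enorm_distC.
    move=> u /H hu; have := enorm_distD (g (tau s)) (g u) (g (tau t)).
    rewrite (enorm_distC (g (tau s))); lra.
  lra.
Qed.

End FromFlatness.

End TameParametrization.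

(** * Tame curves that are close on a grid are isotopic *)

Section CloseTameCurves.
Context {R : realType} {n : nat}.
Variables (L h rho eta delta m : R) (N : nat) (c c' : R -> 'rV[R]_n).
Let n1 : R := n.+1%:R.
Hypotheses (tc : tame L h rho eta c) (tc' : tame L h rho eta c').
Hypotheses (h0 : 0 < h) (hL : h < L) (NmE : N%:R * m = L) (m_le : m <= h / 8).
Hypotheses (eta0 : 0 <= eta) (eta_le : 20 * eta <= n1^-1).
Hypotheses (delta_eta : 4 * delta <= eta * h).
Hypothesis delta_rho : 4 * (delta + 2 * m) <= rho / n1.
Let D i s : R := c' s ord0 i - c s ord0 i.
Hypothesis grid : forall i k, (k <= 2 * N)%N ->
  `|D i (k%:R * m) - D i 0| <= delta.

Let L0 : 0 < L. Proof. exact: lt_trans hL. Qed.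

Let m0 : 0 < m.
Proof.
rewrite ltNge; apply/negP => m_le0.
by have := mulr_ge0_le0 (ler0n R N) m_le0; rewrite NmE leNgt L0.
Qed.

Let grid_below (s : R) : 0 <= s -> exists k : nat, k%:R * m <= s < k%:R * m + m.
Proof.
move=> s0; exists (Num.truncn (s / m)).
have /andP[h1 h2] := truncn_itv (divr_ge0 s0 (ltW m0)).
by move: h2; rewrite -ler_pdivlMr// h1 ltr_pdivrMr// -natr1 mulrDl mul1r.
Qed.

Let index_le (k : nat) (s : R) : k%:R * m <= s -> s < L -> (k <= N)%N.
Proof.
move=> ks sL; rewrite -(ler_nat R) -(ler_pM2r m0) NmE; lra.
Qed.

Let lipD i (s t : R) : s <= t -> `|D i t - D i s| <= 2 * (t - s).
Proof.
move=> st; have [_ lc _ _] := tc; have [_ lc' _ _] := tc'.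
have -> : D i t - D i s = (c' t ord0 i - c' s ord0 i) - (c t ord0 i - c s ord0 i).
  by rewrite /D; ring.
rewrite (le_trans (ler_normB _ _))// mulr_natl mulr2n lerD//.
  exact: lc'.
exact: lc.
Qed.

(** On an arc of length [w > h / 2] between grid points, the change of [D] is at most
    [2 * delta <= eta * w], so the directions of the two curves differ by at most [3 * eta]. Then
    [D] changes by at most [5 * eta * (t - s)], while the chord of [c] is at least
    [19 * eta * (t - s)]. The arc may pass the end of the period, hence a grid over two periods. *)
Let near_bound (s t : R) : 0 <= s < L -> s <= t -> t - s <= h / 2 ->
  forall i, `|D i t - D i s| <= 2^-1 * `|c t - c s|.
Proof.
move=> /andP[s0 sL] st ts i.
move: (hL) (m_le) (h0) (eta0) (eta_le) (delta_eta) (delta_rho) (L0) (m0).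
move=> hL' m_le' h0' eta0' eta_le' de' dr' L0' m0'.
have [_ _ dc _] := tc; have [_ _ dc' _] := tc'.
have [k /andP[ks sk]] := grid_below s0.
have [j /andP[jh hj]] := grid_below (ltW (divr_gt0 h0 (ltr0n _ 2))).
pose s' := k%:R * m; pose w := j.+1%:R * m.
have wE : w = j%:R * m + m by rewrite /w -natr1 mulrDl mul1r.
have kN : (k <= N)%N by exact: index_le ks sL.
have jN : (j.+1 <= N)%N.
  have wL : w <= L by rewrite wE; lra.
  by rewrite -(ler_nat R) -(ler_pM2r m0) NmE.
have [e e1 He] := dc s'; have [e' _ He'] := dc' s'.
have kjE : (k + j.+1)%N%:R * m = s' + w by rewrite natrD mulrDl.
have ee a : `|e' ord0 a - e ord0 a| <= 3 * eta.
  have g1 : `|D a (s' + w) - D a 0| <= delta.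
    by rewrite -kjE; apply: grid; rewrite mul2n -addnn leq_add.
  have g2 : `|D a s' - D a 0| <= delta.
    by apply: grid; rewrite mul2n -addnn (leq_trans kN)// leq_addr.
  have w0 : 0 < w by rewrite mulr_gt0.
  have sw : s' + w - s' = w by ring.
  have h1 := He a s' (s' + w) (lexx _); have h2 := He' a s' (s' + w) (lexx _).
  have {}h1 : `|c (s' + w) ord0 a - c s' ord0 a - w * e ord0 a| <= eta * w.
    by have := h1 _ _; rewrite sw; apply; lra.
  have {}h2 : `|c' (s' + w) ord0 a - c' s' ord0 a - w * e' ord0 a| <= eta * w.
    by have := h2 _ _; rewrite sw; apply; lra.
  have : `|w * (e' ord0 a - e ord0 a)| <= w * (3 * eta).
    have dw : 2 * delta <= eta * w.
      by have : eta * (h / 2) <= eta * w by [apply: ler_wpM2l => //; lra]; lra.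
    move: h1 h2 g1 g2; rewrite /D !ler_norml; lra.
  by rewrite normrM gtr0_norm// ler_pM2l.
have ds : s' <= s by [].
have th : t <= s' + h by rewrite /s'; lra.
have ts0 : 0 <= t - s by rewrite subr_ge0.
have Dle : `|D i t - D i s| <= 5 * eta * (t - s).
  have h1 := He i s t ds st th; have h2 := He' i s t ds st th.
  have h3 : `|(t - s) * (e' ord0 i - e ord0 i)| <= (t - s) * (3 * eta).
    by rewrite normrM ger0_norm// ler_wpM2l.
  move: h1 h2 h3; rewrite /D !ler_norml; lra.
have [a ea] := unit_coord e1.
have h1 := He a s t ds st th.
have h2 : (t - s) * n1^-1 <= (t - s) * `|e ord0 a| by rewrite ler_wpM2l.
have h3 : (t - s) * `|e ord0 a| <= `|c t - c s| + eta * (t - s).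
  rewrite -{1}(ger0_norm ts0) -normrM.
  have -> : (t - s) * e ord0 a = (c t ord0 a - c s ord0 a) -
    (c t ord0 a - c s ord0 a - (t - s) * e ord0 a) by ring.
  rewrite (le_trans (ler_normB _ _))// lerD//.
  by have := coord_le_norm (c t - c s) a; rewrite !mxE.
have h4 : (t - s) * (20 * eta) <= (t - s) * n1^-1 by rewrite ler_wpM2l.
have h5 : 0 <= eta * (t - s) by rewrite mulr_ge0.
have := le_trans h4 (le_trans h2 h3).
rewrite (_ : (t - s) * (20 * eta) = 20 * (eta * (t - s))); last by ring.
move: Dle; rewrite -mulrA; move: (eta * (t - s)) h5 => x x0; lra.
Qed.

(** [D] is within [delta + 2 * m] of its value at 0, the [2 * m] for rounding down to the grid;
    twice this is at most half of the separation in the maximum norm. *)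
Let far_bound (s t : R) : 0 <= s < L -> 0 <= t < L -> h / 2 < t - s ->
  t - s < L - h / 2 -> forall i, `|D i t - D i s| <= 2^-1 * `|c t - c s|.
Proof.
move=> /andP[s0 sL] /andP[t0 tL] ts1 ts2 i.
move: (hL) (m_le) (h0) (eta0) (eta_le) (delta_eta) (delta_rho) (L0) (m0).
move=> hL' m_le' h0' eta0' eta_le' de' dr' L0' m0'.
have [_ _ _ far] := tc.
have to0 (u : R) : 0 <= u -> u < L -> `|D i u - D i 0| <= delta + 2 * m.
  move=> u0 uL; have [k /andP[ku uk]] := grid_below u0.
  have kN : (k <= 2 * N)%N.
    by rewrite (leq_trans (index_le ku uL))// mul2n -addnn leq_addr.
  have -> : D i u - D i 0 = (D i (k%:R * m) - D i 0) + (D i u - D i (k%:R * m)).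
    by ring.
  rewrite (le_trans (ler_normD _ _))// lerD// ?grid//.
  rewrite (le_trans (lipD i ku))// ler_pM2l// lerBlDl; exact: ltW.
have hr := far s t ts1 ts2.
have h1 : rho / n1 <= `|c t - c s|.
  rewrite ler_pdivrMr// (le_trans hr)// mulrC (le_trans (enorm_le_norm _))//.
  by rewrite ler_wpM2r// ler_nat.
have -> : D i t - D i s = (D i t - D i 0) - (D i s - D i 0) by ring.
rewrite (le_trans (ler_normB _ _))//.
rewrite (le_trans (lerD (to0 t t0 tL) (to0 s s0 sL)))//.
by have := le_trans dr' h1; lra.
Qed.

Let periodL (f : R -> 'rV[R]_n) : (forall s, f (s + L) = f s) ->
  forall (k : int) s, f (s + k%:~R * L) = f s.
Proof.
move=> pf k s.
have p1 : periodic1 (fun u => f (u * L)) by move=> u; rewrite mulrDl mul1r pf.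
have := periodic1_int p1 k (s / L).
by rewrite mulrDl divfK ?gt_eqF.
Qed.

Lemma tame_close_isotopic : ambient_isotopic (range c) (range c').
Proof.
move: (hL) (m_le) (h0) (eta0) (eta_le) (delta_eta) (delta_rho) (L0) (m0).
move=> hL' m_le' h0' eta0' eta_le' de' dr' L0' m0'.
have [pc _ _ _] := tc; have [pc' _ _ _] := tc'.
have pD s : (c' (s + L) - c (s + L) = c' s - c s) by rewrite pc pc'.
have ordered (s t : R) : 0 <= s < L -> 0 <= t < L -> s <= t ->
    `|(c' t - c t) - (c' s - c s)| <= 2^-1 * `|c t - c s|.
  move=> sI tI st; apply: norm_le_coord; first by rewrite mulr_ge0.
  move=> i; have -> : (c' t - c t - (c' s - c s)) ord0 i = D i t - D i s.
    by rewrite !mxE.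
  have [ts|ts] := leP (t - s) (h / 2); first exact: near_bound.
  have [ts2|ts2] := ltP (t - s) (L - h / 2); first exact: far_bound.
  (* The points are close across the end of the period: [near_bound] is used from [t] to [s + L]. *)
  have /andP[s0 sL] := sI; have /andP[t0 tL] := tI.
  have := near_bound (s := t) (t := s + L) tI _ _ i; rewrite pc.
  rewrite {1}/D pc pc' -/(D i s) distrC (distrC (c s)); apply; lra.
apply: (lipschitz_close_isotopic 0) => s t.
have red (u : R) : exists2 k : int, 0 <= u + k%:~R * L < L & True.
  exists (- Num.floor (u / L)) => //; rewrite mulrNz mulNr.
  have /andP[f1 f2] := floor_itv (u / L); move: f1 f2.
  by rewrite ler_pdivlMr// ltr_pdivrMr// intrD mulrDl mul1r; lra.
have [k sI _] := red s; have [k' tI _] := red t.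
rewrite -(periodL pc k s) -(periodL pc' k s) -(periodL pc k' t) -(periodL pc' k' t).
have [st|/ltW ts] := leP (s + k%:~R * L) (t + k'%:~R * L).
  by rewrite distrC (distrC (c _)); exact: ordered.
exact: ordered.
Qed.

End CloseTameCurves.

(** * Finiteness of the set of knot types *)

(** Codes form a relation because a knot type receives one through a representative, which is not
    unique. *)
Lemma finite_set_code {T : Type} {C : finType} (S : set T) (P : T -> C -> Prop) :
  (forall x, S x -> exists d, P x d) ->
  (forall x y d, S x -> S y -> P x d -> P y d -> x = y) -> finite_set S.
Proof.
move=> ex inj.
have [[x0 Sx0]|S0] := pselect (exists x, S x); last first.
  by rewrite (_ : S = set0)//; apply/seteqP; split => // x Sx; apply: S0; exists x.
have [d|F HF] := @choice _ _
    (fun d y => (exists2 x, S x & P x d) -> S y /\ P y d).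
  have [[x Sx Px]|nP] := pselect (exists2 x, S x & P x d); first by exists x.
  by exists x0 => /nP.
apply: (@sub_finite_set _ _ (F @` [set: C])) => [x Sx|]; last first.
  exact/finite_image/finite_finset.
have [d Pd] := ex x Sx; exists d => //.
have [SF PF] := HF d (ex_intro2 _ _ x Sx Pd).
exact: inj SF Sx PF Pd.
Qed.

Section Finiteness.
Context {R : realType} {n : nat}.
Implicit Types (g c : R -> 'rV[R]_n).

Lemma C1_speed_minorant g : C1_curve g ->
  speed_minorant g (fun t => enorm (derive1 g t)).
Proof.
move=> g1; have cs := C1_speed_continuous g1; have [l gl] := primitive_exists cs.
split=> [|t|a b _ ab _].
- exact: continuous_measurable_fun.
- by rewrite enorm_ge0 lexx.
rewrite (integral_primitive ab cs gl) lee_fin ler_pdivrMr//.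
have /le_trans->// : enorm (g b - g a) <= n%:R * (l b - l a).
  by apply: enorm_le_coord => i; rewrite !mxE chord_le_arc.
by rewrite mulrC ler_wpM2l ?ler_nat// subr_ge0 (arc_length_le gl).
Qed.

Lemma truncn_eq_dist (x y : R) : 0 <= x -> 0 <= y ->
  Num.truncn x = Num.truncn y -> `|x - y| <= 1.
Proof.
move=> x0 y0 xy; have /andP[] := truncn_itv x0; have /andP[] := truncn_itv y0.
rewrite xy -natr1 ler_norml; lra.
Qed.

Lemma tame_codes (L h rho eta : R) : 0 < h -> h < L -> 0 < rho -> 0 < eta ->
  20 * eta <= n.+1%:R^-1 ->
  exists (C : finType) (code : (R -> 'rV[R]_n) -> C), forall c c',
    tame L h rho eta c -> tame L h rho eta c' -> code c = code c' ->
    ambient_isotopic (range c) (range c').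
Proof.
move=> h0 hL rho0 eta0 eta_le; have L0 := lt_trans h0 hL.
pose z := rho / (16 * n.+1%:R); have z0 : 0 < z by rewrite divr_gt0// mulr_gt0.
have zE : rho / n.+1%:R = 16 * z.
  have n0 : n.+1%:R != 0 :> R by rewrite pnatr_eq0.
  by rewrite /z; move: n.+1%:R n0 => x x0; field.
pose m0 := Num.min (h / 8) z.
have m00 : 0 < m0 by rewrite lt_min z0 divr_gt0.
pose N := (Num.truncn (L / m0)).+1; pose m := L / N%:R.
have N0 : 0 < N%:R :> R by rewrite ltr0n.
have NmE : N%:R * m = L by rewrite mulrC divfK ?gt_eqF.
have mm0 : m <= m0.
  rewrite ler_pdivrMr// -ler_pdivrMl// mulrC.
  by have /andP[_ /ltW] := truncn_itv (ltW (divr_gt0 L0 m00)).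
have m_le : m <= h / 8 by rewrite (le_trans mm0)// ge_min lexx.
have m_z : m <= z by rewrite (le_trans mm0)// ge_min lexx orbT.
pose delta := Num.min (eta * h / 4) z.
have delta0 : 0 < delta by rewrite lt_min z0 andbT divr_gt0// mulr_gt0.
have d1 : delta <= eta * h / 4 by rewrite ge_min lexx.
have d2 : delta <= z by rewrite ge_min lexx orbT.
pose B := Num.truncn (4 * L / delta).
(* Over two periods the increments from [c 0] are at most [2 * L] in absolute value; the shift makes
   them nonnegative before truncation. *)
pose u c (k : nat) i := (c (k%:R * m) ord0 i - c 0 ord0 i + 2 * L) / delta.
exists {ffun 'I_(2 * N).+1 * 'I_n -> 'I_B.+1},
  (fun c => [ffun ki : _ * _ => inord (Num.truncn (u c (ki.1 : 'I__) ki.2))]).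
have m_ge0 : 0 <= m by rewrite divr_ge0// ltW.
have u_bound c k i : tame L h rho eta c -> (k <= 2 * N)%N ->
    0 <= u c k i <= 4 * L / delta.
  move=> [_ lc _ _] kN; have km0 : 0 <= k%:R * m by rewrite mulr_ge0.
  have kmL : k%:R * m <= 2 * L.
    by rewrite -NmE mulrA ler_wpM2r// -natrM ler_nat.
  have := lc i 0 (k%:R * m) km0; rewrite subr0 ler_norml => /andP[l1 l2].
  apply/andP; split; first by rewrite divr_ge0 ?(ltW delta0)//; lra.
  by rewrite ler_pM2r ?invr_gt0//; lra.
move=> c c' tc tc' /ffunP codeE.
have dr : 4 * (delta + 2 * m) <= rho / n.+1%:R by rewrite zE; lra.
have de : 4 * delta <= eta * h by lra.
apply: (tame_close_isotopic tc tc' h0 hL NmE m_le (ltW eta0) eta_le de dr).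
move=> i k kN.
have kN' : (k < (2 * N).+1)%N by [].
have /(congr1 val) := codeE (Ordinal kN', i); rewrite !ffunE/=.
have /andP[u0 uB] := u_bound c k i tc kN.
have /andP[u0' uB'] := u_bound c' k i tc' kN.
rewrite !inordK ?ltnS ?le_truncn// => uE.
have := truncn_eq_dist u0' u0 (esym uE).
have -> : u c' k i - u c k i = (c' (k%:R * m) ord0 i - c (k%:R * m) ord0 i -
    (c' 0 ord0 i - c 0 ord0 i)) / delta by rewrite /u; ring.
by rewrite normrM normfV (gtr0_norm delta0) ler_pdivrMr// mul1r.
Qed.

Lemma knot_type_eq K K' g g' : is_knot_type K -> is_knot_type K' ->
  K g -> K' g' -> ambient_isotopic (range g) (range g') -> K = K'.
Proof.
move=> [g0 _ ->] [g0' _ ->] [_ gg] [_ gg'] iso.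
have i0 : ambient_isotopic (range g0) (range g0').
  apply: ambient_isotopic_trans gg _; apply: ambient_isotopic_trans iso _.
  exact: ambient_isotopic_sym.
apply/seteqP; split => c [ec gc]; split => //.
  by apply: ambient_isotopic_trans gc; exact: ambient_isotopic_sym.
exact: ambient_isotopic_trans gc.
Qed.

Lemma finite_knot_types (p q E L : R) : 1 < q -> 2 / 3 * q + 1 < p ->
  0 < E -> 0 < L ->
  finite_set [set K : set (R -> 'rV[R]_n) | is_knot_type K /\
    exists g, [/\ K g, C1_curve g, (intM p q g <= E%:E)%E &
                  curve_length g = L%:E]].
Proof.
move=> q1 qp E0 L0.
pose n1 : R := n.+1%:R; have n10 : 0 < n1 by rewrite ltr0n.
have n11 : 1 <= n1 by rewrite ler1n.
pose eta := (20 * n1)^-1.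
have eta0 : 0 < eta by rewrite invr_gt0 mulr_gt0.
have etaE : 20 * eta = n1^-1 by rewrite /eta invfM mulrA divff ?mul1r// pnatr_eq0.
have n1V : n1^-1 <= 1 by rewrite invf_le1.
pose d := eta / 2; have d2 : 2 * d = eta by rewrite mulrC divfK.
have d01 : 0 <= d < 1.
  move: n1V d2 eta0; rewrite -etaE; move: (d) (eta) => x y; lra.
have d_le : 2 * d <= (2 * n.+1%:R)^-1.
  rewrite d2 invfM -/n1 -etaE; move: eta0; move: (eta) => y; lra.
have d0 : 0 < d by rewrite divr_gt0.
have [r r0 Hr] := @energy_flat R n p q E d q1 qp E0 d0.
(* The second term makes an arc of length [h] fit in a ball of radius [r / 2], as chords are at most
   n + 1 times the arc length. *)
pose h := Num.min (L / 2) (r / (2 * n1)).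
have h0 : 0 < h by rewrite lt_min !divr_gt0// mulr_gt0.
have hL : h < L.
  by have : h <= L / 2 by [rewrite ge_min lexx]; lra.
have h0L : 0 < h < L by rewrite h0.
have hr : n.+1%:R * h <= r / 2.
  have hle : h <= r / (2 * n1) by rewrite ge_min lexx orbT.
  rewrite -/n1 -ler_pdivlMl// (le_trans hle)//.
  by rewrite invfM mulrA mulrC.
pose rho := h / (4 * n1).
have rho0 : 0 < rho by rewrite divr_gt0// mulr_gt0.
have eta_le : 20 * eta <= n1^-1 by rewrite etaE.
have [C [code Hcode]] := tame_codes h0 hL rho0 eta0 eta_le.
apply: (@finite_set_code _ _ _ (fun K x => exists g c,
    [/\ K g, tame L h rho eta c, range c = range g & code c = x])).
  move=> K [[g0 _ KE] [g [Kg g1 gE gL]]].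
  have eg : embedded g by move: Kg; rewrite KE => -[].
  have [cg pg _] := eg.
  have gf := Hr g _ cg pg (C1_speed_minorant g1) gE.
  have [l gl] := primitive_exists (C1_speed_continuous g1).
  have [c tc rc] := tame_parametrization g1 eg gl gL L0 gf d01 d_le h0L hr.
  rewrite d2 in tc.
  by exists (code c), g, c.
move=> K K' x [hK _] [hK' _] [g [c [Kg tc rc cx]]] [g' [c' [Kg' tc' rc' cx']]].
apply: knot_type_eq hK hK' Kg Kg' _; rewrite -rc -rc'.
by apply: Hcode => //; rewrite cx.
Qed.

End Finiteness.

Theorem proposition2p4 (R : realType) (n : nat) (p q : R)
    (hq : 1 < q) (hp : 2 / 3 * q + 1 < p < q + 2 / 3) :
  (forall (gam : nat -> R -> 'rV[R]_n) (gam_oo : R -> 'rV[R]_n),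
     (forall k, embedded (gam k)) ->
     (forall k, sobolev_slobodeckij ((3 * p - 2) / q - 1) q (gam k)) ->
     periodic1 gam_oo ->
     C01_curve gam_oo ->
     arc_length_parametrized gam_oo ->
     ~ injective_curve gam_oo ->
     {uniform, gam @ \oo --> gam_oo} ->
     intM p q (gam k) @[k --> \oo] --> +oo%E)
  /\
  (forall E L : R, 0 < E -> 0 < L ->
     finite_set [set K : set (R -> 'rV[R]_n) |
       is_knot_type K /\
       exists g, [/\ K g, C1_curve g, regular_curve g,
                     (intM p q g < E%:E)%E & curve_length g = L%:E]]).
Proof.
have /andP[pq _] := hp; split => [gam gam_oo eg sg pg _ al ninj cg|].
  apply: energy_blowup cg => // k; have [cgk pgk _] := eg k.
  have [_ [h [Lh wh _]]] := sg k.
  exact: sobolev_speed_minorant hq cgk pgk Lh wh.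
move=> E L E0 L0; apply: sub_finite_set (finite_knot_types (n := n) hq pq E0 L0).
by move=> K [hK [g [Kg g1 _ /ltW gE gL]]]; split => //; exists g.
Qed.
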